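(* Let $q$ be a left-invariant pseudo-Riemannian metric on $\mathrm{SL}(2,\mathbb{R})$ whose associated isomorphism $\Phi$ has a real eigenvalue $\lambda$ whose algebraic multiplicity exceeds its geometric multiplicity by exactly $1$, with Lax vector field $$E=bz_3^2\frac{\partial}{\partial z_1}-z_1(az_2+bz_3)\frac{\partial}{\partial z_2}+az_1z_3\frac{\partial}{\partial z_3},\qquad a=\eta-\nu,\quad b=\zeta\nu^2,$$ on $\mathbb{R}^3$, and assume $ab>0$. Let $L\subset\mathbb{R}^3\setminus\{0\}$ be a trajectory of $E$ and let $L_\infty$ be its image under the projection $(z_1,z_2,z_3)\mapsto[z_1:z_2:z_3]\in\mathbb{RP}(2)$. The geodesic associated with $L$ is complete if $L_\infty$ is contained in the line $\{z_3=0\}$ of $\mathbb{RP}(2)$, and is incomplete in the other cases. An incomplete geodesic is $\mathbb{R}^+$-complete or $\mathbb{R}^-$-complete if $L_\infty$ is not contained in the strip $\{z_3\ne0,\ -\sqrt{b/a}<z_1/z_3<\sqrt{b/a}\}$; in other words, if $L_\infty$ is not a leaf joining the points $p_1=[\sqrt{b/a}:-b/(2a):1]$ and $p_2=[-\sqrt{b/a}:-b/(2a):1]$.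
   Context: Let $B(x,y)=2\,\mathrm{Tr}(xy)$ on $\mathfrak{sl}(2,\mathbb{R})$ (one half of the Killing form). The associated isomorphism of $q$ is the unique $B$-self-adjoint linear isomorphism $\Phi$ with $q(x,y)=B(\Phi x,y)$. Under the stated hypothesis on $\Phi$, one fixes a basis $(v_1,v_2,v_3)$ of $\mathfrak{sl}(2,\mathbb{R})$ with $B(v_1,v_1)=B(v_2,v_3)=1$, $B(v_1,v_2)=B(v_1,v_3)=B(v_2,v_2)=B(v_3,v_3)=0$, $[v_1,v_2]=v_2$, $[v_1,v_3]=-v_3$, $[v_2,v_3]=v_1$, and $\Phi v_1=\mu v_1$, $\Phi v_2=\lambda v_2$, $\Phi v_3=\zeta v_2+\lambda v_3$ with $\zeta=q(v_3,v_3)\neq0$; put $\eta=1/\mu$, $\nu=1/\lambda$, and let $(z_1,z_2,z_3)$ be the coordinates of $z\in\mathfrak{sl}(2,\mathbb{R})$ in this basis. A curve $\gamma$ is a geodesic of $q$ iff $z(t)=\Phi(\gamma(t)^{-1}\dot\gamma(t))$ solves $\dot z=[z,\Phi^{-1}z]$, i.e. is an integral curve of $E$; maximal geodesics and corresponding maximal integral curves have the same interval of definition, and the geodesic associated with a trajectory $L$ is the one so corresponding to it. A geodesic is complete if its maximal interval of definition is $\mathbb{R}$, and $\mathbb{R}^+$-complete (resp. $\mathbb{R}^-$-complete) if this interval is unbounded above (resp. below). *)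

(* Defs.v *)
From HB Require Import structures.
From mathcomp Require Import all_boot all_order all_algebra.
From mathcomp Require Import all_classical all_reals all_analysis.

Set Implicit Arguments.
Unset Strict Implicit.
Unset Printing Implicit Defensive.

Import Order.TTheory GRing.Theory Num.Theory passmx.
Import numFieldNormedType.Exports.

Local Open Scope classical_set_scope.
Local Open Scope ring_scope.
Local Open Scope quotient_scope.

(** * The Lie algebra sl(2,R) *)

Definition sl2_vs (R : realType) : {vspace 'M[R]_2} :=
  lker (linfun (@mxtrace R 2 : 'M[R]_2 -> R^o)).

Notation sl2 R := (subvs_of (sl2_vs R)).

Lemma mem_sl2 (R : realType) (M : 'M[R]_2) : (M \in sl2_vs R) = (\tr M == 0).
Proof. by rewrite memv_ker lfunE. Qed.

(* A commutator has trace 0, so the projection [vsproj] only changes the type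
   of its argument (see [val_lie]). *)
Definition lie (R : realType) (x y : sl2 R) : sl2 R :=
  vsproj (sl2_vs R) (vsval x *m vsval y - vsval y *m vsval x).

Lemma val_lie (R : realType) (x y : sl2 R) :
  vsval (lie x y) = vsval x *m vsval y - vsval y *m vsval x.
Proof. by rewrite vsprojK// mem_sl2 linearB/= mxtrace_mulC subrr. Qed.

Definition half_killing (R : realType) (x y : sl2 R) : R :=
  2 * \tr (vsval x *m vsval y).

(** * Left-invariant metrics and their geodesics *)

(* A left-invariant pseudo-Riemannian metric is given by its value [q] at the
   identity: on the tangent space at [g] it is
   (u, v) |-> q (g^-1 u, g^-1 v). *)
Definition left_invariant_metric (R : realType) (q : sl2 R -> sl2 R -> R) :=
  [/\ forall (c : R) x x' y, q (c *: x + x') y = c * q x y + q x' y,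
      forall x y, q x y = q y x
    & forall x, (forall y, q x y = 0) -> x = 0].

Definition associated_iso (R : realType) (q : sl2 R -> sl2 R -> R)
    (Phi : 'End(sl2 R)) :=
  [/\ lker Phi = 0%VS,
      forall x y, half_killing (Phi x) y = half_killing x (Phi y)
    & forall x y, q x y = half_killing (Phi x) y].

(* The Levi-Civita connection of [q], restricted to left-invariant vector
   fields.  As [q x y] is constant for left-invariant fields x and y,
   compatibility with the metric reads q (D_x y, z) + q (y, D_x z) = 0. *)
Definition levi_civita (R : realType) (q : sl2 R -> sl2 R -> R)
    (D : sl2 R -> sl2 R -> sl2 R) :=
  [/\ forall (c : R) x x' y, D (c *: x + x') y = c *: D x y + D x' y,
      forall (c : R) x y y', D x (c *: y + y') = c *: D x y + D x y',
      forall x y, D x y - D y x = lie x y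
    & forall x y z, q (D x y) z + q y (D x z) = 0].

Definition open_interval (R : realType) (J : set R) :=
  [/\ open J, is_interval J & J !=set0].

(* The left-trivialised velocity g^-1 g'.  When [g] stays in SL(2,R) this
   matrix has trace 0, so [vsproj] only changes its type. *)
Definition velocity (R : realType) (g : R -> 'M[R]_2) (t : R) : sl2 R :=
  vsproj (sl2_vs R) (invmx (g t) *m derive1 g t).

(* With x = g^-1 g', the covariant derivative of g' along g is
   g (x' + D_x x). *)
Definition geodesic (R : realType) (q : sl2 R -> sl2 R -> R)
    (g : R -> 'M[R]_2) (J : set R) :=
  open_interval J /\
  exists2 D : sl2 R -> sl2 R -> sl2 R, levi_civita q D &
    forall t, J t ->
      [/\ \det (g t) = 1, derivable g t 1
        & is_derive t (1 : R) (fun s => vsval (velocity g s))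
            (- vsval (D (velocity g t) (velocity g t)))].

(* Curves are total functions of which only the values on the interval [J]
   matter. *)
Definition maximal_on (R : realType) (T : Type)
    (P : (R -> T) -> set R -> Prop) (c : R -> T) (J : set R) :=
  P c J /\
  forall (c' : R -> T) (J' : set R), P c' J' -> J `<=` J' ->
    (forall t, J t -> c' t = c t) -> J' = J.

Definition complete_on (R : realType) (J : set R) := J = setT.
Definition pos_complete_on (R : realType) (J : set R) := ~ has_ubound J.
Definition neg_complete_on (R : realType) (J : set R) := ~ has_lbound J.

(** * Multiplicities of an eigenvalue *)

Definition alg_mult (R : realType) (Phi : 'End(sl2 R)) (l : R) : nat :=
  mup l (char_poly (mxof (vbasis {: sl2 R}) (vbasis {: sl2 R}) Phi)).

Definition geom_mult (R : realType) (Phi : 'End(sl2 R)) (l : R) : nat :=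
  \dim (leigenspace Phi l).

(** * The adapted basis and the Lax vector field *)

Definition adapted_basis (R : realType) (q : sl2 R -> sl2 R -> R)
    (Phi : 'End(sl2 R)) (lambda mu zeta : R) (v1 v2 v3 : sl2 R) :=
  [/\ basis_of {: sl2 R} [:: v1; v2; v3],
      [/\ half_killing v1 v1 = 1, half_killing v2 v3 = 1, half_killing v1 v2 = 0
        & [/\ half_killing v1 v3 = 0, half_killing v2 v2 = 0 & half_killing v3 v3 = 0]],
      [/\ lie v1 v2 = v2, lie v1 v3 = - v3 & lie v2 v3 = v1],
      [/\ Phi v1 = mu *: v1, Phi v2 = lambda *: v2
        & Phi v3 = zeta *: v2 + lambda *: v3]
    & zeta = q v3 v3 /\ zeta != 0].

Definition lax_field (R : realType) (a b : R) (z : 'rV[R]_3) : 'rV[R]_3 :=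
  let z1 := z 0 0 in let z2 := z 0 1 in let z3 := z 0 2 in
  \row_i [:: b * z3 ^+ 2; - z1 * (a * z2 + b * z3); a * z1 * z3]`_i.

Definition integral_curve (R : realType) (E : 'rV[R]_3 -> 'rV[R]_3)
    (z : R -> 'rV[R]_3) (J : set R) :=
  open_interval J /\ forall t, J t -> is_derive t (1 : R) z (E (z t)).

Definition trajectory (R : realType) (E : 'rV[R]_3 -> 'rV[R]_3)
    (L : set 'rV[R]_3) :=
  exists z J, maximal_on (integral_curve E) z J /\ L = z @` J.

Definition lax_curve (R : realType) (Phi : 'End(sl2 R)) (v1 v2 v3 : sl2 R)
    (g : R -> 'M[R]_2) (t : R) : 'rV[R]_3 :=
  \row_i coord [tuple v1; v2; v3] i (Phi (velocity g t)).

Definition geodesic_of_trajectory (R : realType) (q : sl2 R -> sl2 R -> R)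
    (Phi : 'End(sl2 R)) (v1 v2 v3 : sl2 R) (L : set 'rV[R]_3)
    (g : R -> 'M[R]_2) (J : set R) :=
  maximal_on (geodesic q) g J /\ lax_curve Phi v1 v2 v3 g @` J = L.

(** * The projective plane *)

Definition punctured (R : realType) : set 'rV[R]_3 := [set z | z != 0].
Arguments punctured : clear implicits.

Definition same_line (R : realType) (u v : punctured R) : bool :=
  (set_val u == set_val v)%MS.

Lemma same_line_equiv (R : realType) : equiv_class_of (@same_line R).
Proof.
rewrite /same_line; split=> [u|u v|v u w].
- exact/eqmxP.
- by rewrite andbC.
- by move=> /eqmxP uv /eqmxP vw; apply/eqmxP; apply: eqmx_trans uv vw.
Qed.

Canonical same_line_equivRel (R : realType) := EquivRelPack (same_line_equiv R).

Definition RP2 (R : realType) :=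
  quotient_topology {eq_quot (same_line_equivRel R)}.

Definition rp2_pi (R : realType) (u : punctured R) : RP2 R :=
  \pi_{eq_quot (same_line_equivRel R)} u.

(* The image in RP(2) of a subset of R^3, the origin being discarded. *)
Definition proj_image (R : realType) (A : set 'rV[R]_3) : set (RP2 R) :=
  @rp2_pi R @` (set_val @^-1` A).

Definition affine_row (R : realType) (x y : R) : 'rV[R]_3 :=
  \row_i [:: x; y; 1]`_i.

Lemma affine_row_punctured (R : realType) (x y : R) :
  affine_row x y \in punctured R.
Proof.
apply/mem_set; apply/eqP => /rowP/(_ 2); rewrite !mxE/= => /eqP.
by rewrite oner_eq0.
Qed.

(* The point [x : y : 1]. *)
Definition affine_point (R : realType) (x y : R) : RP2 R :=
  rp2_pi (Sub (affine_row x y) (affine_row_punctured x y) : punctured R).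

Definition line_z3 (R : realType) : set (RP2 R) :=
  proj_image [set z | z 0 2 = 0].
Arguments line_z3 : clear implicits.

Definition strip (R : realType) (r : R) : set (RP2 R) :=
  proj_image [set z | z 0 2 != 0 /\ - r < z 0 0 / z 0 2 < r].

(* The ends of the interval [J], as filters: t tends to sup J, resp. inf J,
   inside J. *)
Definition upper_end (R : realType) (J : set R) : set_system R :=
  filter_from J (fun s => [set t | J t /\ s <= t]).
Definition lower_end (R : realType) (J : set R) : set_system R :=
  filter_from J (fun s => [set t | J t /\ t <= s]).

(* [F] is the projection of a trajectory of [E] and tends to [p] and [p'] at
   its two ends, in one order or the other. *)
Definition leaf_joining (R : realType) (E : 'rV[R]_3 -> 'rV[R]_3)
    (F : set (RP2 R)) (p p' : RP2 R) :=
  exists (c : R -> punctured R) (J : set R),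
    [/\ maximal_on (integral_curve E) (fun t => set_val (c t)) J,
        F = (fun t => rp2_pi (c t)) @` J
      & ((fun t => rp2_pi (c t)) @ lower_end J --> p /\
         (fun t => rp2_pi (c t)) @ upper_end J --> p') \/
        ((fun t => rp2_pi (c t)) @ lower_end J --> p' /\
         (fun t => rp2_pi (c t)) @ upper_end J --> p)].

(* Main.v *)
(* Along the Lax flow [z1^2 + 2 z2 z3] and [a z1^2 - b z3^2] are constant.
   Where z3 does not vanish, [y = z3(t0) / z3] therefore solves the linear
   equation [y'' = k y], [k = a (a z1^2 - b z3^2)], and z is a rational function
   of [y] and [y']: the integral curves are defined exactly as long as [y > 0].
   As [k < (y' / y)^2], [y] vanishes somewhere, on both sides of t0 if [k < 0],
   on one side only if [k >= 0]; and [k < 0] means that the projected curve lies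
   in the strip.  In the chart [z3 = 1] of RP(2) this curve is polynomial in [y]
   and [y'], hence extends continuously to the zeros of [y], where it takes the
   values p1 and p2.

   A geodesic exists as long as its Lax curve does, because the equation
   [g^-1 g' = Phi^-1 z] can be solved explicitly: [Phi^-1 z] is
   [nu z + (a z1 v1 - b z3 v2)], and if P is a curve in the Borel subgroup of
   {v1, v2} with [P^-1 P' = a z1 v1 - b z3 v2], then [P z P^-1] is a constant Z0
   by the Lax equation and [g = exp(nu t Z0) P] is a solution. *)

Require Import Defs.
From HB Require Import structures.
From mathcomp Require Import all_boot all_order all_algebra.
From mathcomp Require Import all_classical all_reals all_analysis.
From mathcomp Require Import ring lra.

Set Implicit Arguments.
Unset Strict Implicit.
Unset Printing Implicit Defensive.

Import Order.TTheory GRing.Theory Num.Theory passmx.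
Import numFieldNormedType.Exports.

Local Open Scope classical_set_scope.
Local Open Scope ring_scope.

(** * Calculus on an interval *)

Section Calculus.
Context {R : realType}.
Implicit Types (f g : R -> R) (t u v : R) (J : set R).

(** The differentiation rules are restated for explicit abstractions over real functions, so that
    derivatives of composite formulas can be assembled as terms. *)
Lemma is_derive_funD f g t u v : is_derive t 1 f u -> is_derive t 1 g v ->
  is_derive t 1 (fun s => f s + g s) (u + v).
Proof. exact: is_deriveD. Qed.

Lemma is_derive_funB f g t u v : is_derive t 1 f u -> is_derive t 1 g v ->
  is_derive t 1 (fun s => f s - g s) (u - v).
Proof. exact: is_deriveB. Qed.

Lemma is_derive_funN f t u : is_derive t 1 f u ->
  is_derive t 1 (fun s => - f s) (- u).
Proof. exact: is_deriveN. Qed.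

Lemma is_derive_funM f g t u v : is_derive t 1 f u -> is_derive t 1 g v ->
  is_derive t 1 (fun s => f s * g s) (f t * v + g t * u).
Proof. exact: is_deriveM. Qed.

Lemma is_derive_funZ f t u (k : R) : is_derive t 1 f u ->
  is_derive t 1 (fun s => k * f s) (k * u).
Proof. exact: is_deriveZ. Qed.

Lemma is_derive_funV f t u : f t != 0 -> is_derive t 1 f u ->
  is_derive t 1 (fun s => (f s)^-1) (- u / f t ^+ 2).
Proof.
move=> f0 df; apply: (is_derive_eq (is_deriveV f0 df)).
by rewrite -[_ *: _]/(_ * _) !mulNr mulrC.
Qed.

Lemma is_derive_fun_cst (k t : R) : is_derive t 1 (fun _ : R => k) 0.
Proof. exact: is_derive_cst. Qed.

Lemma is_derive_fun_comp f g t u v : is_derive (g t) 1 f u ->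
  is_derive t 1 g v -> is_derive t 1 (fun s => f (g s)) (u * v).
Proof. exact: is_derive1_comp. Qed.

Lemma is_derive_shiftB (t0 t : R) : is_derive t 1 (fun s => s - t0) 1.
Proof.
by apply: is_derive_eq; rewrite subr0.
Qed.

Lemma is_derive_continuous f t u : is_derive t 1 f u -> {for t, continuous f}.
Proof. by move=> [df _]; apply/differentiable_continuous/derivable1_diffP. Qed.

Lemma is_derive_mxP m n (M : R -> 'M[R]_(m, n)) t (D : 'M[R]_(m, n)) :
  is_derive t 1 M D <-> forall i j, is_derive t 1 (fun s => M s i j) (D i j).
Proof.
split=> [[dM <-] i j|dM].
  by rewrite (derive_mx dM) mxE; apply: derivableP; exact: (derivable_mxP _ _ _).1.
have dvM : derivable M t 1.
  by apply/derivable_mxP => i j; have [] := dM i j.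
split => //; rewrite (derive_mx dvM); apply/matrixP => i j; rewrite mxE.
by have [] := dM i j.
Qed.

Lemma is_derive_fun_sum n (F : 'I_n -> R -> R) t (D : 'I_n -> R) :
  (forall i, is_derive t 1 (F i) (D i)) ->
  is_derive t 1 (fun s => \sum_i F i s) (\sum_i D i).
Proof.
move=> dF; have -> : (fun s => \sum_i F i s) = \sum_i F i.
  by apply/funext => s; rewrite fct_sumE.
exact: (@is_derive_sum _ _ _ _ F t 1 D dF).
Qed.

Lemma is_derive_mulmx m n p (M : R -> 'M[R]_(m, n)) (N : R -> 'M[R]_(n, p)) t
    (dM : 'M[R]_(m, n)) (dN : 'M[R]_(n, p)) :
  is_derive t 1 M dM -> is_derive t 1 N dN ->
  is_derive t 1 (fun s => M s *m N s) (dM *m N t + M t *m dN).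
Proof.
move=> /is_derive_mxP hM /is_derive_mxP hN; apply/is_derive_mxP => i j.
have -> : (fun s => (M s *m N s) i j) = (fun s => \sum_k M s i k * N s k j).
  by apply/funext => s; rewrite mxE.
rewrite !mxE -big_split; apply: is_derive_fun_sum => k.
apply: (is_derive_eq (is_derive_funM (hM i k) (hN k j))).
by rewrite /= addrC [N t k j * _]mulrC.
Qed.

Lemma open_near_eq (T : Type) (f g : R -> T) J t : open J -> J t ->
  (forall s, J s -> f s = g s) -> \near t, f t = g t.
Proof. by move=> oJ Jt fg; apply: filterS (open_nbhs_nbhs (conj oJ Jt)). Qed.

Lemma interval_sub_itvcc J s t : is_interval J -> J s -> J t ->
  forall x, x \in `[s, t] -> J x.
Proof. by move=> iJ Js Jt x; rewrite in_itv/=; exact: iJ. Qed.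

Lemma interval_cst f J : is_interval J ->
  (forall t, J t -> is_derive t 1 f 0) ->
  forall s t, J s -> J t -> f s = f t.
Proof.
move=> iJ df s t; wlog st : s t / s <= t => [hw Js Jt|Js Jt].
  by have [/hw->//|/ltW/hw->] := leP s t.
have sub := interval_sub_itvcc iJ Js Jt.
have [||c _] := @MVT_segment R f (cst 0) s t st.
- by move=> x /subset_itv_oo_cc/sub; exact: df.
- apply: continuous_in_subspaceT => x; rewrite inE => /sub Jx.
  exact: is_derive_continuous (df _ Jx).
- by rewrite mul0r => /eqP; rewrite subr_eq0 => /eqP.
Qed.

Lemma interval_IVT0 f J s t : is_interval J ->
  (forall x, J x -> {for x, continuous f}) ->
  J s -> J t -> f s <= 0 -> 0 <= f t -> exists2 x, J x & f x = 0.
Proof.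
move=> iJ cf Js Jt fs ft.
have [st|/ltW ts] := leP s t.
  have sub := interval_sub_itvcc iJ Js Jt.
  have [||x /sub Jx fx0] := @IVT R f s t 0 st; last by exists x.
    by apply: continuous_in_subspaceT => x; rewrite inE => /sub; exact: cf.
  by rewrite ge_min le_max fs ft orbT.
have sub := interval_sub_itvcc iJ Jt Js.
have [||x /sub Jx fx0] := @IVT R f t s 0 ts; last by exists x.
  by apply: continuous_in_subspaceT => x; rewrite inE => /sub; exact: cf.
by rewrite ge_min le_max fs ft orbT.
Qed.

Lemma interval_pos f J t0 : is_interval J ->
  (forall x, J x -> {for x, continuous f}) -> (forall x, J x -> f x != 0) ->
  J t0 -> 0 < f t0 -> forall x, J x -> 0 < f x.
Proof.
move=> iJ cf f0 Jt0 ft0 x Jx; rewrite ltNge; apply/negP => fx.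
have [y Jy fy] := interval_IVT0 iJ cf Jx Jt0 fx (ltW ft0).
by have := f0 _ Jy; rewrite fy eqxx.
Qed.

End Calculus.

(** * Solutions of y'' = k y for k of any sign *)

Section GeneralizedHyperbolic.
Context {R : realType}.
Implicit Types (k m t w : R).

(** [gcosh k] and [gsinh k] are the solutions of y'' = k y with initial data (1, 0) and (0, 1) at 0;
    the case split keeps them real for negative k. *)
Definition gcosh k t : R :=
  if 0 < k then (expR (Num.sqrt k * t) + expR (- (Num.sqrt k * t))) / 2
  else if k < 0 then cos (Num.sqrt (- k) * t) else 1.

Definition gsinh k t : R :=
  if 0 < k then
    (expR (Num.sqrt k * t) - expR (- (Num.sqrt k * t))) / (2 * Num.sqrt k)
  else if k < 0 then sin (Num.sqrt (- k) * t) / Num.sqrt (- k) else t.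

(** Case analysis replaces both functions at once and writes k as plus or minus a square [w ^+ 2],
    so that no square root is left in the goals. *)
Variant gcosh_spec k : (R -> R) -> (R -> R) -> Type :=
| GcoshPos w of 0 < w & k = w ^+ 2 :
    gcosh_spec k (fun t => (expR (w * t) + expR (- (w * t))) / 2)
      (fun t => (expR (w * t) - expR (- (w * t))) / (2 * w))
| GcoshNeg w of 0 < w & k = - w ^+ 2 :
    gcosh_spec k (fun t => cos (w * t)) (fun t => sin (w * t) / w)
| GcoshZero of k = 0 : gcosh_spec k (fun=> 1) id.

Lemma gcoshP k : gcosh_spec k (gcosh k) (gsinh k).
Proof.
have [k0|k0|k0] := ltgtP k 0.
- have w0 : 0 < Num.sqrt (- k) by rewrite sqrtr_gt0 oppr_gt0.
  have -> : gcosh k = fun t => cos (Num.sqrt (- k) * t).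
    by apply/funext => t; rewrite /gcosh ltNge ltW//= k0.
  have -> : gsinh k = fun t => sin (Num.sqrt (- k) * t) / Num.sqrt (- k).
    by apply/funext => t; rewrite /gsinh ltNge ltW//= k0.
  by apply: GcoshNeg => //; rewrite sqr_sqrtr ?opprK// oppr_ge0 ltW.
- have w0 : 0 < Num.sqrt k by rewrite sqrtr_gt0.
  have -> : gcosh k =
      fun t => (expR (Num.sqrt k * t) + expR (- (Num.sqrt k * t))) / 2.
    by apply/funext => t; rewrite /gcosh k0.
  have -> : gsinh k = fun t =>
      (expR (Num.sqrt k * t) - expR (- (Num.sqrt k * t))) / (2 * Num.sqrt k).
    by apply/funext => t; rewrite /gsinh k0.
  by apply: GcoshPos => //; rewrite sqr_sqrtr// ltW.
- have -> : gcosh k = fun=> 1 by apply/funext => t; rewrite /gcosh k0 !ltxx.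
  have -> : gsinh k = id by apply/funext => t; rewrite /gsinh k0 !ltxx.
  exact: GcoshZero.
Qed.

Lemma is_derive_mull w t : is_derive t 1 (fun s => w * s) w.
Proof.
by apply: (is_derive_eq (is_derive_funZ w (is_derive_id t 1))); rewrite mulr1.
Qed.

Lemma is_derive_gcosh k t : is_derive t 1 (gcosh k) (k * gsinh k t).
Proof.
have dm w := is_derive_mull w t.
case: gcoshP => [w w0 ->|w w0 ->|->].
- have dp := is_derive_fun_comp (is_derive_expR (w * t)) (dm w).
  have dn := is_derive_fun_comp (g := fun s => - (w * s)) 
    (is_derive_expR _) (is_derive_funN (dm w)).
  apply: (is_derive_eq (is_derive_funM (is_derive_funD dp dn)
    (is_derive_fun_cst 2^-1 t))).
  by rewrite /=; field; rewrite gt_eqF.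
- apply: (is_derive_eq (is_derive_fun_comp (is_derive_cos (w * t)) (dm w))).
  by rewrite /=; field; rewrite gt_eqF.
- by rewrite mul0r; exact: is_derive_fun_cst.
Qed.

Lemma is_derive_gsinh k t : is_derive t 1 (gsinh k) (gcosh k t).
Proof.
have dm w := is_derive_mull w t.
case: gcoshP => [w w0 _|w w0 _|_].
- have dp := is_derive_fun_comp (is_derive_expR (w * t)) (dm w).
  have dn := is_derive_fun_comp (g := fun s => - (w * s)) 
    (is_derive_expR _) (is_derive_funN (dm w)).
  apply: (is_derive_eq (is_derive_funM (is_derive_funB dp dn)
    (is_derive_fun_cst (2 * w)^-1 t))).
  by rewrite /=; field; rewrite gt_eqF.
- have ds := is_derive_fun_comp (is_derive_sin (w * t)) (dm w).
  apply: (is_derive_eq (is_derive_funM ds (is_derive_fun_cst w^-1 t))).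
  by rewrite /=; field; rewrite gt_eqF.
- exact: is_derive_id.
Qed.

Lemma gcosh0 k : gcosh k 0 = 1.
Proof.
by case: gcoshP => [w _ _|w _ _|_] //; rewrite mulr0 ?cos0// oppr0 expR0; field.
Qed.

Lemma gsinh0 k : gsinh k 0 = 0.
Proof.
case: gcoshP => [w _ _|w _ _|_] //; rewrite mulr0 ?sin0 ?mul0r//.
by rewrite oppr0 subrr mul0r.
Qed.

(** This is the Wronskian of the two fundamental solutions. *)
Lemma gcosh2Bsinh2 k t : gcosh k t ^+ 2 - k * gsinh k t ^+ 2 = 1.
Proof.
case: gcoshP => [w w0 ->|w w0 ->|->].
- rewrite expRN; field; rewrite gt_eqF//=.
  by rewrite gt_eqF// expR_gt0.
- rewrite -(cos2Dsin2 (w * t)); field; by rewrite gt_eqF.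
- by rewrite mul0r subr0 expr1n.
Qed.

(** For k nonnegative, [gcosh] is positive and [gsinh] has the sign of t, so the subtracted term is
    at most 0. *)
Lemma gcoshB_sinh_gt0 k m t : 0 <= k -> m * t <= 0 ->
  0 < gcosh k t - m * gsinh k t.
Proof.
move=> k0; case: gcoshP => [w w0 _|w w0 kw|_] mt.
- rewrite subr_gt0 (@le_lt_trans _ _ 0)//; last first.
    by rewrite divr_gt0// addr_gt0// expR_gt0.
  have [t0|t0] := leP 0 t.
    have [->|tn0] := eqVneq t 0; first by rewrite mulr0 oppr0 subrr mul0r mulr0.
    rewrite mulr_le0_ge0//.
      by rewrite -(pmulr_lle0 m (x := t))// lt_neqAle eq_sym tn0.
    rewrite divr_ge0// ?subr_ge0 ?mulr_ge0// ?(ltW w0)//.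
    by rewrite ler_expR -subr_ge0 opprK addr_ge0// mulr_ge0// ltW.
  rewrite mulr_ge0_le0//.
    by rewrite -(nmulr_lle0 m (x := t)).
  rewrite mulr_le0_ge0// ?invr_ge0 ?mulr_ge0// ?(ltW w0)//.
  by rewrite subr_le0 ler_expR; nra.
- by move: k0; rewrite kw oppr_ge0 leNgt exprn_gt0.
- by rewrite subr_gt0 (le_lt_trans mt).
Qed.

(* For [k = - w^2] and [tan psi = m / w],
   [gcosh k t - m gsinh k t = cos (w t + psi) / cos psi]. *)
Lemma gcoshB_sinh_neg k m : k < 0 -> exists ab : R * R,
  [/\ ab.1 < 0, 0 < ab.2, gcosh k ab.1 - m * gsinh k ab.1 = 0,
      gcosh k ab.2 - m * gsinh k ab.2 = 0
    & forall t, ab.1 < t < ab.2 -> 0 < gcosh k t - m * gsinh k t].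
Proof.
case: gcoshP => [w w0 ->|w w0 _ _|->]; last by rewrite ltxx.
  by rewrite ltNge sqr_ge0.
pose psi := atan (m / w).
have cpsi : 0 < cos psi.
  by apply: cos_gt0_pihalf; rewrite atan_gtNpi2 atan_ltpi2.
have mE : m = w * sin psi / cos psi.
  have := atanK (m / w); rewrite /tan -/psi -mulrA => ->.
  by field; rewrite gt_eqF.
have NE t : cos (w * t) - m * (sin (w * t) / w) = cos (w * t + psi) / cos psi.
  by rewrite cosD mE; field; rewrite !gt_eqF.
have w_neq0 : w != 0 by rewrite gt_eqF.
(* These are the times at which w t + psi equals -pi/2 and pi/2; they surround 0 because psi lies
   strictly between these two values. *)
exists ((- (pi / 2) - psi) / w, (pi / 2 - psi) / w); split => /=.
- by rewrite pmulr_llt0 ?invr_gt0// subr_lt0 atan_gtNpi2.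
- by rewrite divr_gt0// subr_gt0 atan_ltpi2.
- by rewrite NE mulrCA divff// mulr1 subrK cosN cos_pihalf mul0r.
- by rewrite NE mulrCA divff// mulr1 subrK cos_pihalf mul0r.
- move=> t; rewrite ltr_pdivrMr// ltr_pdivlMr// => /andP[tl tu].
  rewrite NE divr_gt0// cos_gt0_pihalf//.
  by apply/andP; split; lra.
Qed.

(** For k = w^2 > 0, put x = exp(w t): the equation becomes x^2 = (m + w) / (m - w), whose right
    side is positive exactly because w^2 < m^2. For k = 0 the zero is 1/m, and k < 0 is the
    trigonometric case. *)
Lemma gcoshB_sinh_zero k m : k < m ^+ 2 ->
  exists t, gcosh k t - m * gsinh k t = 0.
Proof.
move=> km; have [k0|k0] := ltP k 0.
  by have [ab [_ _ ab0 _ _]] := gcoshB_sinh_neg m k0; exists ab.1.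
case: gcoshP km k0 => [w w0 ->|w w0 ->|->] km k0.
- have w_neq0 : w != 0 by rewrite gt_eqF.
  have mw : m - w != 0.
    by apply: contraTneq km => mw; rewrite (_ : m = w) ?ltxx//; lra.
  have q0 : 0 < (m + w) / (m - w).
    have -> : (m + w) / (m - w) = (m ^+ 2 - w ^+ 2) / (m - w) ^+ 2 by field.
    by rewrite divr_gt0 ?subr_gt0// exprn_even_gt0.
  exists (ln ((m + w) / (m - w)) / (2 * w)).
  set x := expR _.
  have x2 : x ^+ 2 = (m + w) / (m - w).
    rewrite -expRM_natl -[RHS]lnK ?posrE//; congr expR.
    by rewrite -[2%:R]/(2 : R); field.
  have x0 : x != 0 by rewrite gt_eqF// expR_gt0.
  rewrite expRN -/x.
  have -> : (x + x^-1) / 2 - m * ((x - x^-1) / (2 * w)) =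
      ((w + m) - x ^+ 2 * (m - w)) / (2 * w * x) by field; rewrite x0 w_neq0.
  by rewrite x2 divfK// [w + m]addrC subrr mul0r.
- by move: k0; rewrite oppr_ge0 leNgt exprn_gt0.
- have m0 : m != 0 by apply: contraTneq km => ->; rewrite expr0n ltxx.
  by exists m^-1; rewrite divff// subrr.
Qed.

End GeneralizedHyperbolic.

(** * The Lax vector field *)

Section LinearODE.
Context {R : realType}.
Implicit Types (f g h y : R -> R) (J : set R).

(** A Gronwall argument: if |h| is at most K between t0 and t, then y^2 exp(2 K s) is nondecreasing
    and y^2 exp(-2 K s) is nonincreasing there. Both vanish at t0, which forces y to vanish on
    either side of t0. *)
Lemma linear_ode_zero h y J t0 : is_interval J ->
  (forall t, J t -> {for t, continuous h}) ->
  (forall t, J t -> is_derive t 1 y (h t * y t)) ->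
  J t0 -> y t0 = 0 -> forall t, J t -> y t = 0.
Proof.
move=> iJ ch dy Jt0 y0 t Jt.
(* A bound is needed on the closed segment between the two times only; on all of J, h may be
   unbounded. *)
have bound s u : J s -> J u -> exists K, forall x, x \in `[s, u] -> `|h x| <= K.
  move=> Js Ju; have sub := interval_sub_itvcc iJ Js Ju.
  have [us|su] := ltP u s.
    by exists 0 => x; rewrite in_itv/= => /andP[/le_trans H /H]; rewrite leNgt us.
  have cnh : {within `[s, u], continuous (fun x => `|h x|)}.
    apply: continuous_in_subspaceT => x; rewrite inE => /sub Jx.
    by apply: continuous_comp; [exact: ch|exact: norm_continuous].
  have [m _ hm] := EVT_max su cnh.
  by exists `|h m| => x xs; exact: hm.
pose F K s := y s ^+ 2 * expR (2 * K * s).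
pose F' K s := (h s + K) * (2 * y s ^+ 2 * expR (2 * K * s)).
have dF K s : J s -> is_derive s 1 (F K) (F' K s).
  move=> Js.
  have de := is_derive_fun_comp (is_derive_expR (2 * K * s)) (is_derive_mull (2 * K) s).
  apply: (is_derive_eq (is_derive_funM (is_derive_funM (dy s Js) (dy s Js)) de)).
  by rewrite /F'; ring.
have F_le0 K : F K t <= 0 -> y t = 0.
  rewrite pmulr_lle0 ?expR_gt0// => yt; apply/eqP; rewrite -sqrf_eq0 eq_le yt.
  exact: sqr_ge0.
have F0 K : F K t0 = 0 by rewrite /F y0 expr0n mul0r.
(* After t0 the nonincreasing weight (constant -K) is used, before t0 the nondecreasing one. *)
have [t0t|/ltW tt0] := leP t0 t.
  have [K hK] := bound _ _ Jt0 Jt.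
  have sub := interval_sub_itvcc iJ Jt0 Jt.
  apply: (F_le0 (- K)); rewrite -subr_le0 -[X in _ - X <= _](F0 (- K)) ?subr0.
  have [x xs||c ct ->] := @MVT_segment R (F (- K)) (F' (- K)) _ _ t0t.
    by apply: dF; apply: sub; exact: subset_itv_oo_cc xs.
    apply: continuous_in_subspaceT => x; rewrite inE => /sub Jx.
    exact: is_derive_continuous (dF _ _ Jx).
  rewrite mulr_le0_ge0 ?subr_ge0// mulr_le0_ge0//; last first.
    by rewrite mulr_ge0 ?expR_ge0// mulr_ge0// sqr_ge0.
  by rewrite subr_le0 (le_trans (ler_norm _))// hK.
have [K hK] := bound _ _ Jt Jt0.
have sub := interval_sub_itvcc iJ Jt Jt0.
apply: (F_le0 K); rewrite -oppr_ge0 -sub0r -[X in X - _](F0 K).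
have [x xs||c ct ->] := @MVT_segment R (F K) (F' K) _ _ tt0.
  by apply: dF; apply: sub; exact: subset_itv_oo_cc xs.
  apply: continuous_in_subspaceT => x; rewrite inE => /sub Jx.
  exact: is_derive_continuous (dF _ _ Jx).
rewrite mulr_ge0 ?subr_ge0// mulr_ge0//; last first.
  by rewrite mulr_ge0 ?expR_ge0// mulr_ge0// sqr_ge0.
by rewrite -lerBlDr sub0r lerNl (le_trans _ (hK _ ct))// -normrN ler_norm.
Qed.

(** P and Q below are the pair (f, g) multiplied by the inverse of the fundamental matrix, whose
    determinant is 1 by [gcosh2Bsinh2]. They have derivative 0, and inverting the matrix again gives
    the formulas. *)
Lemma gcosh_ode_unique k f g J t0 : is_interval J ->
  (forall t, J t -> is_derive t 1 f (g t)) ->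
  (forall t, J t -> is_derive t 1 g (k * f t)) ->
  J t0 -> forall t, J t ->
  f t = f t0 * gcosh k (t - t0) + g t0 * gsinh k (t - t0) /\
  g t = f t0 * (k * gsinh k (t - t0)) + g t0 * gcosh k (t - t0).
Proof.
move=> iJ df dg Jt0 t Jt.
have dC (s : R) : is_derive s 1 (fun s : R => gcosh k (s - t0)) (k * gsinh k (s - t0)).
  apply: (is_derive_eq (is_derive_fun_comp (is_derive_gcosh k _) (is_derive_shiftB t0 s))).
  by rewrite mulr1.
have dS (s : R) : is_derive s 1 (fun s : R => gsinh k (s - t0)) (gcosh k (s - t0)).
  apply: (is_derive_eq (is_derive_fun_comp (is_derive_gsinh k _) (is_derive_shiftB t0 s))).
  by rewrite mulr1.
pose P s := gcosh k (s - t0) * f s - gsinh k (s - t0) * g s.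
pose Q s := gcosh k (s - t0) * g s - k * gsinh k (s - t0) * f s.
have PE : P t = P t0.
  apply: (interval_cst iJ) => // s Js.
  apply: (is_derive_eq (is_derive_funB (is_derive_funM (dC s) (df s Js))
    (is_derive_funM (dS s) (dg s Js)))).
  by ring.
have QE : Q t = Q t0.
  apply: (interval_cst iJ) => // s Js.
  apply: (is_derive_eq (is_derive_funB (is_derive_funM (dC s) (dg s Js))
    (is_derive_funM (is_derive_funZ k (dS s)) (df s Js)))).
  by ring.
move: PE QE; rewrite /P /Q !subrr gcosh0 gsinh0 !mulr0 !mul0r !mul1r !subr0 => <- <-.
have CS := gcosh2Bsinh2 k (t - t0).
split; rewrite -[LHS]mul1r -CS; ring.
Qed.

End LinearODE.

(** * First integrals and explicit solutions of the Lax flow *)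

Section LaxFlow.
Context {R : realType}.
Implicit Types (z : R -> 'rV[R]_3) (J : set R) (s t : R).

Definition row3 (u v w : R) : 'rV[R]_3 := \row_i [:: u; v; w]`_i.

Lemma row3E0 (u v w : R) : row3 u v w 0 0 = u. Proof. by rewrite mxE. Qed.
Lemma row3E1 (u v w : R) : row3 u v w 0 1 = v. Proof. by rewrite mxE. Qed.
Lemma row3E2 (u v w : R) : row3 u v w 0 2 = w. Proof. by rewrite mxE. Qed.
Definition row3E := (row3E0, row3E1, row3E2).

Lemma row3_eta (u : 'rV[R]_3) : u = row3 (u 0 0) (u 0 1) (u 0 2).
Proof.
apply/rowP => i; rewrite mxE.
case: i => -[|[|[|//]]] i3 /=; congr (u 0 _); exact/val_inj.
Qed.

Lemma is_derive_row3 (f g h : R -> R) t u v w :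
  is_derive t 1 f u -> is_derive t 1 g v -> is_derive t 1 h w ->
  is_derive t 1 (fun s => row3 (f s) (g s) (h s)) (row3 u v w).
Proof.
move=> df dg dh; apply/is_derive_mxP => j i; rewrite mxE.
case: i => -[|[|[|//]]] i3 /=.
- by rewrite (_ : (fun s => _) = f)//; apply/funext => s; rewrite mxE.
- by rewrite (_ : (fun s => _) = g)//; apply/funext => s; rewrite mxE.
- by rewrite (_ : (fun s => _) = h)//; apply/funext => s; rewrite mxE.
Qed.

Context (a b : R).
Hypothesis ab0 : 0 < a * b.

Lemma lax_a_neq0 : a != 0.
Proof using ab0. by apply: contraTneq ab0 => ->; rewrite mul0r ltxx. Qed.
Let a_neq0 := lax_a_neq0.

Lemma lax_fieldE (u : 'rV[R]_3) : lax_field a b u =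
  row3 (b * u 0 2 ^+ 2) (- u 0 0 * (a * u 0 1 + b * u 0 2)) (a * u 0 0 * u 0 2).
Proof. by []. Qed.

Lemma lax_curve_derive z J : integral_curve (lax_field a b) z J ->
  forall t, J t ->
  [/\ is_derive t 1 (fun s => z s 0 0) (b * z t 0 2 ^+ 2),
      is_derive t 1 (fun s => z s 0 1) (- z t 0 0 * (a * z t 0 1 + b * z t 0 2))
    & is_derive t 1 (fun s => z s 0 2) (a * z t 0 0 * z t 0 2)].
Proof.
move=> [_ dz] t /dz/is_derive_mxP d.
by have := (d 0 0, d 0 1, d 0 2); rewrite lax_fieldE !row3E => -[[]].
Qed.

Section Invariants.
Variables (z : R -> 'rV[R]_3) (J : set R).
Hypothesis hz : integral_curve (lax_field a b) z J.
Let iJ : is_interval J. Proof. by have [[]] := hz. Qed.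
Let dz := lax_curve_derive hz.

(** In the adapted basis this quantity is [half_killing] of z with itself, which is invariant
    because a Lax equation is tangent to the adjoint orbits. *)
Lemma lax_casimir s t : J s -> J t ->
  z s 0 0 ^+ 2 + 2 * z s 0 1 * z s 0 2 = z t 0 0 ^+ 2 + 2 * z t 0 1 * z t 0 2.
Proof using hz.
apply: (interval_cst (f := fun s => z s 0 0 ^+ 2 + 2 * z s 0 1 * z s 0 2) iJ).
move=> x /dz[d1 d2 d3].
apply: (is_derive_eq (is_derive_funD (is_derive_funM d1 d1)
  (is_derive_funM (is_derive_funZ 2 d2) d3))).
by ring.
Qed.

(** For a = eta - nu and b = zeta nu^2, this is the energy q(x, x) of the velocity x = Phi^-1 z,
    minus nu times the Casimir function. *)
Lemma lax_energy s t : J s -> J t ->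
  a * z s 0 0 ^+ 2 - b * z s 0 2 ^+ 2 = a * z t 0 0 ^+ 2 - b * z t 0 2 ^+ 2.
Proof using hz.
apply: (interval_cst (f := fun s => a * z s 0 0 ^+ 2 - b * z s 0 2 ^+ 2) iJ).
move=> x /dz[d1 d2 d3].
apply: (is_derive_eq (is_derive_funB (is_derive_funZ a (is_derive_funM d1 d1))
  (is_derive_funZ b (is_derive_funM d3 d3)))).
by ring.
Qed.

(** The third equation z3' = (a z1) z3 is linear in z3, so z3 vanishes everywhere or nowhere along a
    curve. *)
Lemma lax_z3_zero t0 : J t0 -> z t0 0 2 = 0 -> forall t, J t -> z t 0 2 = 0.
Proof using hz.
apply: (linear_ode_zero (h := fun t => a * z t 0 0) (y := fun t => z t 0 2) iJ).
- by move=> t /dz[d1 _ _]; exact: is_derive_continuous (is_derive_funZ a d1).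
- by move=> t /dz[].
Qed.

End Invariants.

(* [lax_den A B s] is [z3(t0) / z3(t0 + s)] when [z1(t0) = A] and [z3(t0) = B];
   [lax_dden] is its derivative. *)
Definition lax_k (A B : R) := a ^+ 2 * A ^+ 2 - a * b * B ^+ 2.
Definition lax_den A B s :=
  gcosh (lax_k A B) s - a * A * gsinh (lax_k A B) s.
Definition lax_dden A B s :=
  lax_k A B * gsinh (lax_k A B) s - a * A * gcosh (lax_k A B) s.

(* Here k is the value of the Casimir function [z1^2 + 2 z2 z3]. *)
Definition lax_sol t0 A B k t : R * R * R :=
  let D := lax_den A B (t - t0) in let D' := lax_dden A B (t - t0) in
  (- D' / (a * D), (k - (D' / (a * D)) ^+ 2) * D / (2 * B), B / D).

Lemma lax_den0 A B : lax_den A B 0 = 1.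
Proof. by rewrite /lax_den gcosh0 gsinh0 mulr0 subr0. Qed.

(** The left side is the first integral y'^2 - k y^2 of y'' = k y; its value at s = 0 is (a A)^2 -
    [lax_k A B]. *)
Lemma lax_dden_sqr A B s :
  lax_dden A B s ^+ 2 - lax_k A B * lax_den A B s ^+ 2 = a * b * B ^+ 2.
Proof.
transitivity ((a ^+ 2 * A ^+ 2 - lax_k A B) *
    (gcosh (lax_k A B) s ^+ 2 - lax_k A B * gsinh (lax_k A B) s ^+ 2)).
  by rewrite /lax_den /lax_dden; ring.
by rewrite gcosh2Bsinh2 /lax_k; ring.
Qed.

Lemma is_derive_lax_den A B t0 t :
  is_derive t 1 (fun s => lax_den A B (s - t0)) (lax_dden A B (t - t0)).
Proof.
have d : is_derive (t - t0) 1 (lax_den A B) (lax_dden A B (t - t0)).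
  exact: (is_derive_funB (is_derive_gcosh _ _)
    (is_derive_funZ (a * A) (is_derive_gsinh _ _))).
apply: (is_derive_eq (is_derive_fun_comp (g := fun s => s - t0) d
  (is_derive_shiftB t0 t))).
by rewrite mulr1.
Qed.

Lemma is_derive_lax_dden A B t0 t : is_derive t 1
  (fun s => lax_dden A B (s - t0)) (lax_k A B * lax_den A B (t - t0)).
Proof.
have d : is_derive (t - t0) 1 (lax_dden A B) (lax_k A B * lax_den A B (t - t0)).
  apply: (is_derive_eq (is_derive_funB
    (is_derive_funZ (lax_k A B) (is_derive_gsinh _ _))
    (is_derive_funZ (a * A) (is_derive_gcosh _ _)))).
  by rewrite /lax_den; ring.
apply: (is_derive_eq (is_derive_fun_comp (g := fun s => s - t0) d
  (is_derive_shiftB t0 t))).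
by rewrite mulr1.
Qed.

Lemma lax_sol_derive t0 A B k t : B != 0 -> lax_den A B (t - t0) != 0 ->
  let z1 s := (lax_sol t0 A B k s).1.1 in
  let z2 s := (lax_sol t0 A B k s).1.2 in
  let z3 s := (lax_sol t0 A B k s).2 in
  [/\ is_derive t 1 z1 (b * z3 t ^+ 2),
      is_derive t 1 z2 (- z1 t * (a * z2 t + b * z3 t))
    & is_derive t 1 z3 (a * z1 t * z3 t)].
Proof using ab0.
move=> B0 D0 z1 z2 z3.
have dD := is_derive_lax_den A B t0 t.
have dD' := is_derive_lax_dden A B t0 t.
have E := lax_dden_sqr A B (t - t0).
have aD0 : a * lax_den A B (t - t0) != 0 by rewrite mulf_neq0.
have dV := is_derive_funV (f := fun s => a * lax_den A B (s - t0)) aD0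
  (is_derive_funZ a dD).
have d1 := is_derive_funM (is_derive_funN dD') dV.
have dq := is_derive_funM dD' dV.
have d2 := is_derive_funM (is_derive_funM
  (is_derive_funB (is_derive_fun_cst k t) (is_derive_funM dq dq)) dD)
  (is_derive_fun_cst (2 * B)^-1 t).
have d3 := is_derive_funM (is_derive_fun_cst B t)
  (is_derive_funV (f := fun s => lax_den A B (s - t0)) D0 dD).
split; [apply: (is_derive_eq d1)|apply: (is_derive_eq d2)|apply: (is_derive_eq d3)];
  rewrite /z1 /z2 /z3 /lax_sol /=; move: D0 E;
  move: (lax_den A B _) (lax_dden A B _) (lax_k A B) => D D' K D0 E;
  (* The first integral is solved for b; after this substitution the three equations are rational
     identities. *)
  have bE : b = (D' ^+ 2 - K * D ^+ 2) / (a * B ^+ 2)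
    by [rewrite E; field; rewrite B0 a_neq0]; rewrite ?bE; field;
  by rewrite ?B0 ?D0 ?a_neq0.
Qed.

Definition lax_row t0 A B k t :=
  let s := lax_sol t0 A B k t in row3 s.1.1 s.1.2 s.2.

Lemma lax_row_integral t0 A B k J : B != 0 -> open_interval J ->
  (forall t, J t -> lax_den A B (t - t0) != 0) ->
  integral_curve (lax_field a b) (lax_row t0 A B k) J.
Proof using ab0.
move=> B0 oJ D0; split => // t Jt; rewrite lax_fieldE !row3E.
by have [d1 d2 d3] := lax_sol_derive k B0 (D0 _ Jt); exact: is_derive_row3.
Qed.

(** The quotient y = B / z3 satisfies y' = - a z1 y and, by conservation of energy, y'' =
    [lax_k A B] y, so y is [lax_den]. Then z3 and z1 are read off from y and y', and z2 from the
    Casimir function. *)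
Lemma lax_solE z J t0 : integral_curve (lax_field a b) z J ->
  J t0 -> z t0 0 2 != 0 ->
  let A : R := z t0 0 0 in let B : R := z t0 0 2 in
  let k := A ^+ 2 + 2 * z t0 0 1 * B in
  forall t, J t -> 0 < lax_den A B (t - t0) /\ z t = lax_row t0 A B k t.
Proof using ab0.
move=> hz Jt0 B0 A B k.
have iJ : is_interval J by have [[]] := hz.
have dz := lax_curve_derive hz.
have z30 t : J t -> z t 0 2 != 0.
  by move=> Jt; apply: contraNneq B0 => zt; rewrite (lax_z3_zero hz Jt zt).
have ode t : J t -> B / z t 0 2 = lax_den A B (t - t0) /\
    - (a * z t 0 0 * (B / z t 0 2)) = lax_dden A B (t - t0).
  move=> Jt; have [| |-> ->] := gcosh_ode_unique (k := lax_k A B)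
    (f := fun t => B / z t 0 2) (g := fun t => - (a * z t 0 0 * (B / z t 0 2)))
    iJ _ _ Jt0 Jt.
  - move=> x Jx; have [_ _ d3] := dz _ Jx.
    apply: (is_derive_eq (is_derive_funM (is_derive_fun_cst B x)
      (is_derive_funV (z30 _ Jx) d3))).
    by field; exact: z30.
  - move=> x Jx; have [d1 _ d3] := dz _ Jx.
    apply: (is_derive_eq (is_derive_funN (is_derive_funM (is_derive_funZ a d1)
      (is_derive_funM (is_derive_fun_cst B x) (is_derive_funV (z30 _ Jx) d3))))).
    (* The energy at time x equals the energy at t0, so the coefficient of the second-order equation
       is constant. *)
    have -> : lax_k A B = a * (a * z x 0 0 ^+ 2 - b * z x 0 2 ^+ 2).
      by rewrite (lax_energy hz Jx Jt0) -/A -/B /lax_k; ring.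
    by field; exact: z30.
  - rewrite divff// !mul1r /lax_den /lax_dden -/A !mulr1.
    by split; ring.
have D0 t : J t -> lax_den A B (t - t0) != 0.
  by move=> Jt; have [<- _] := ode t Jt; rewrite mulf_neq0// invr_eq0 z30.
(* The denominator is 1 at t0 and has no zero on the interval J, hence it stays positive. *)
move=> t Jt; split.
  apply: (interval_pos (f := fun s => lax_den A B (s - t0)) iJ _ D0 Jt0 _ Jt).
    by move=> x _; exact: is_derive_continuous (is_derive_lax_den A B t0 x).
  by rewrite /= subrr lax_den0.
have [e1 e2] := ode t Jt.
rewrite [LHS]row3_eta /lax_row /lax_sol /=.
have z3E : z t 0 2 = B / lax_den A B (t - t0) by rewrite -e1; field; rewrite B0 z30.
have z1E : z t 0 0 = - lax_dden A B (t - t0) / (a * lax_den A B (t - t0)).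
  by rewrite -e1 -e2; field; rewrite B0 z30// a_neq0.
rewrite -z3E -z1E; congr row3.
rewrite (_ : (_ / _) ^+ 2 = z t 0 0 ^+ 2); last by rewrite z1E; ring.
rewrite /k -(lax_casimir hz Jt Jt0) -e1.
by field; rewrite B0 z30.
Qed.

(** This is where the sign of [a * b] enters: [lax_k A B] falls short of (a A)^2 by a b B^2 > 0. The
    zero obtained is a time that no integral curve with these data can reach. *)
Lemma lax_den_zero A B : B != 0 -> exists s, lax_den A B s = 0.
Proof using ab0.
move=> B0; apply: gcoshB_sinh_zero; rewrite /lax_k exprMn ltrBlDr ltrDl.
by rewrite mulr_gt0// exprn_even_gt0.
Qed.

Lemma lax_den_gt0 A B s : 0 <= lax_k A B -> a * A * s <= 0 -> 0 < lax_den A B s.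
Proof. exact: gcoshB_sinh_gt0. Qed.

End LaxFlow.

(** * The Lie algebra sl(2,R) *)

Section HalfKilling.
Context {R : realType}.
Implicit Types (x y z : sl2 R) (X Y : 'M[R]_2).

Lemma half_killingC x y : half_killing x y = half_killing y x.
Proof. by rewrite /half_killing mxtrace_mulC. Qed.

Lemma half_killingDl x y z :
  half_killing (x + y) z = half_killing x z + half_killing y z.
Proof. by rewrite /half_killing linearD/= mulmxDl linearD/= mulrDr. Qed.

Lemma half_killingZl (k : R) x y : half_killing (k *: x) y = k * half_killing x y.
Proof. by rewrite /half_killing linearZ/= -scalemxAl linearZ/= mulrCA. Qed.

(** Invariance of the form under ad, a consequence of the cyclicity of the trace. *)
Lemma half_killing_lie x y z :
  half_killing x (lie y z) = half_killing (lie x y) z.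
Proof.
rewrite /half_killing !val_lie mulmxBr mulmxBl !linearB/= !mulmxA.
by congr (2 * (_ - _)); rewrite mxtrace_mulC !mulmxA.
Qed.

Lemma sum_ord2 (F : 'I_2 -> R) : \sum_i F i = F 0 + F 1.
Proof.
by rewrite !big_ord_recl big_ord0 addr0; congr (_ + F _); exact/val_inj.
Qed.

Lemma ord2E (i : 'I_2) : i = 0 \/ i = 1.
Proof. by case: i => -[|[|//]] ?; [left|right]; exact/val_inj. Qed.

(** Polarisation of the Cayley-Hamilton identity, which for X of trace 0 reads X^2 = (tr(X^2) / 2)
    I. *)
Lemma anticomm_mx2 X Y : \tr X = 0 -> \tr Y = 0 ->
  X * Y + Y * X = (\tr (X * Y))%:M.
Proof.
rewrite /mxtrace !big_ord_recl !big_ord0/= !addr0.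
rewrite !mxE !big_ord_recl !big_ord0/= !addr0.
rewrite (_ : lift ord0 ord0 = 1); last exact/val_inj.
move=> /eqP; rewrite addr_eq0 => /eqP X0 /eqP; rewrite addr_eq0 => /eqP Y0.
apply/matrixP => i j; rewrite !mxE !big_ord_recl !big_ord0/= !addr0.
rewrite (_ : lift ord0 ord0 = 1); last exact/val_inj.
by case: (ord2E i) => ->; case: (ord2E j) => ->; rewrite ?X0 ?Y0/= ?mulr1n ?mulr0n; ring.
Qed.

(** Newton's identity in degree 2; it allows the determinant to be differentiated through traces. *)
Lemma det_mx2 X : \det X = (\tr X ^+ 2 - \tr (X * X)) / 2.
Proof.
have l0 : lift (0 : 'I_2) (0 : 'I_1) = 1 by exact/val_inj.
have l1 : lift (1 : 'I_2) (0 : 'I_1) = 0 by exact/val_inj.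
rewrite (expand_det_row _ 0) /mxtrace !sum_ord2 /cofactor !det_mx11 !mxE !sum_ord2 l0 l1.
by rewrite /= expr0 expr1; field.
Qed.

End HalfKilling.

(** * Coordinates and matrix products in the adapted basis *)

Section Frame.
Context {R : realType} (v1 v2 v3 : sl2 R).
Hypothesis frame : basis_of {: sl2 R} [:: v1; v2; v3].
Hypothesis gram :
  [/\ half_killing v1 v1 = 1, half_killing v2 v3 = 1, half_killing v1 v2 = 0
    & [/\ half_killing v1 v3 = 0, half_killing v2 v2 = 0 & half_killing v3 v3 = 0]].
Hypothesis bracket : [/\ lie v1 v2 = v2, lie v1 v3 = - v3 & lie v2 v3 = v1].

Definition sl2_comb (x1 x2 x3 : R) : sl2 R := x1 *: v1 + x2 *: v2 + x3 *: v3.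

(** The 2 x 2 matrices are viewed as split quaternions: a scalar part plus a part of trace 0, the
    latter in the adapted basis. *)
Definition quat (x0 x1 x2 x3 : R) : 'M[R]_2 :=
  x0%:M + (x1 *: vsval v1 + x2 *: vsval v2 + x3 *: vsval v3).

Lemma val_sl2_comb x1 x2 x3 : vsval (sl2_comb x1 x2 x3) = quat 0 x1 x2 x3.
Proof. by rewrite /quat /sl2_comb !linearD/= raddf0 add0r. Qed.

Lemma eq_comb x1 x2 x3 y1 y2 y3 : x1 = y1 -> x2 = y2 -> x3 = y3 ->
  sl2_comb x1 x2 x3 = sl2_comb y1 y2 y3.
Proof. by move=> -> -> ->. Qed.

Lemma eq_quat x0 x1 x2 x3 y0 y1 y2 y3 :
  x0 = y0 -> x1 = y1 -> x2 = y2 -> x3 = y3 ->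
  quat x0 x1 x2 x3 = quat y0 y1 y2 y3.
Proof. by move=> -> -> -> ->. Qed.

Lemma quatD x0 x1 x2 x3 y0 y1 y2 y3 : quat x0 x1 x2 x3 + quat y0 y1 y2 y3 =
  quat (x0 + y0) (x1 + y1) (x2 + y2) (x3 + y3).
Proof. by apply/matrixP => i j; rewrite !mxE !mulrDl mulrnDl; ring. Qed.

Lemma quatZ k x0 x1 x2 x3 :
  k *: quat x0 x1 x2 x3 = quat (k * x0) (k * x1) (k * x2) (k * x3).
Proof. by apply/matrixP => i j; rewrite !mxE mulrDr mulrnAr; ring. Qed.

(** The basis dual to (v1, v2, v3) for the form is (v1, v3, v2), so pairing with v2 reads the third
    coordinate and pairing with v3 the second. *)
Lemma half_killing_comb x1 x2 x3 :
  [/\ half_killing (sl2_comb x1 x2 x3) v1 = x1,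
      half_killing (sl2_comb x1 x2 x3) v2 = x3
    & half_killing (sl2_comb x1 x2 x3) v3 = x2].
Proof using gram.
have [h11 h23 h12 [h13 h22 h33]] := gram.
rewrite /sl2_comb !half_killingDl !half_killingZl.
rewrite (half_killingC v2 v1) (half_killingC v3 v1) (half_killingC v3 v2).
rewrite h11 h23 h12 h13 h22 h33.
by split; ring.
Qed.

Lemma sl2_combE (x : sl2 R) :
  x = sl2_comb (half_killing x v1) (half_killing x v3) (half_killing x v2).
Proof using frame gram.
have [y1 [y2 [y3 ->]]] : exists y1 y2 y3, x = sl2_comb y1 y2 y3.
  have xin : x \in <<[tuple v1; v2; v3]>>%VS by rewrite (span_basis frame) memvf.
  rewrite (coord_span xin) !big_ord_recl big_ord0 addr0 addrA /=.
  rewrite /bump/=.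
  set a1 := coord _ _ x; set a2 := coord _ _ x; set a3 := coord _ _ x.
  exists a1, a2, a3; reflexivity.
by have [-> -> ->] := half_killing_comb y1 y2 y3.
Qed.

Lemma coord_combE x1 x2 x3 :
  \row_i coord [tuple v1; v2; v3] i (sl2_comb x1 x2 x3) = row3 x1 x2 x3.
Proof using frame.
have fr : free [tuple v1; v2; v3] := basis_free frame.
apply/rowP => i; rewrite !mxE /sl2_comb.
pose k j := [:: x1; x2; x3]`_j.
rewrite -[RHS](coord_sum_free k i fr); congr coord.
by rewrite !big_ord_recl big_ord0 addr0 addrA.
Qed.

Lemma vsval_trace (x : sl2 R) : \tr (vsval x) = 0.
Proof. by apply/eqP; rewrite -mem_sl2 subvsP. Qed.

Let V1 := vsval v1.
Let V2 := vsval v2.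
Let V3 := vsval v3.

Let quatE x0 x1 x2 x3 :
  quat x0 x1 x2 x3 = x0 *: 1 + x1 *: V1 + x2 *: V2 + x3 *: V3.
Proof. by rewrite /quat -scalemx1 !addrA. Qed.

(** A product is half the sum of the anticommutator, which is a scalar fixed by the Gram matrix, and
    the commutator, which is fixed by the bracket relations. No explicit matrices are needed. *)
Let quat_table :
  [/\ [/\ V1 * V1 = 4^-1 *: 1, V1 * V2 = 2^-1 *: V2 & V1 * V3 = - 2^-1 *: V3],
      [/\ V2 * V1 = - 2^-1 *: V2, V2 * V2 = 0
        & V2 * V3 = 4^-1 *: 1 + 2^-1 *: V1]
    & [/\ V3 * V1 = 2^-1 *: V3, V3 * V2 = 4^-1 *: 1 - 2^-1 *: V1
        & V3 * V3 = 0]].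
Proof.
have halves (X Y S D : 'M[R]_2) : X + Y = S -> X - Y = D ->
    X = 2^-1 *: (S + D) /\ Y = 2^-1 *: (S - D).
  move=> <- <-; by split; apply/matrixP => i j; rewrite !mxE; field.
have anti (x y : sl2 R) : vsval x * vsval y + vsval y * vsval x =
    (half_killing x y / 2) *: 1.
  rewrite (anticomm_mx2 (vsval_trace x) (vsval_trace y)) /half_killing -scalemx1.
  by rewrite [2 * _]mulrC mulfK.
have [h11 h23 h12 [h13 h22 h33]] := gram.
have [/(congr1 (fun x => vsval x)) l12 /(congr1 (fun x => vsval x)) l13
  /(congr1 (fun x => vsval x)) l23] := bracket.
move: l12 l13 l23; rewrite !val_lie linearN/= -/V1 -/V2 -/V3 => l12 l13 l23.
have [e12 e21] := halves _ _ _ _ (anti v1 v2) l12.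
have [e13 e31] := halves _ _ _ _ (anti v1 v3) l13.
have [e23 e32] := halves _ _ _ _ (anti v2 v3) l23.
have sq (x : sl2 R) : vsval x * vsval x = (half_killing x x / 4) *: 1.
  have [-> _] := halves _ _ _ _ (anti x x) (subrr _).
  by rewrite addr0 scalerA; congr (_ *: _); field.
split; split.
- by rewrite sq h11 mul1r.
- by rewrite e12 h12 mul0r scale0r add0r.
- by rewrite e13 h13 mul0r scale0r add0r scalerN scaleNr.
- by rewrite e21 h12 mul0r scale0r add0r scalerN scaleNr.
- by rewrite sq h22 mul0r scale0r.
- by rewrite e23 h23 scalerDr scalerA; congr (_ *: _ + _); field.
- by rewrite e31 h13 mul0r scale0r add0r opprK.
- by rewrite e32 h23 scalerDr scalerN scalerA; congr (_ *: _ + _); field.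
- by rewrite sq h33 mul0r scale0r.
Qed.

Lemma quat_mul x0 x1 x2 x3 y0 y1 y2 y3 :
  quat x0 x1 x2 x3 *m quat y0 y1 y2 y3 =
  quat (x0 * y0 + x1 * y1 / 4 + (x2 * y3 + x3 * y2) / 4)
       (x0 * y1 + x1 * y0 + (x2 * y3 - x3 * y2) / 2)
       (x0 * y2 + x2 * y0 + (x1 * y2 - x2 * y1) / 2)
       (x0 * y3 + x3 * y0 + (x3 * y1 - x1 * y3) / 2).
Proof using gram bracket.
have [[t11 t12 t13] [t21 t22 t23] [t31 t32 t33]] := quat_table.
rewrite -[LHS]/(quat x0 x1 x2 x3 * quat y0 y1 y2 y3) [in RHS]quatE.
set q := RHS; rewrite !quatE !mulrDl !mulrDr -!scalerAl -!scalerAr !mul1r !mulr1.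
rewrite t11 t12 t13 t21 t22 t23 t31 t32 t33 {}/q.
move: (1 : 'M[R]_2) V1 V2 V3 => I W1 W2 W3.
by apply/matrixP => i j; rewrite !mxE; field.
Qed.

(** The right side is the norm of the split quaternion: the squared scalar part minus a quarter of
    [half_killing] of the remaining part with itself. *)
Lemma det_quat x0 x1 x2 x3 :
  \det (quat x0 x1 x2 x3) = x0 ^+ 2 - x1 ^+ 2 / 4 - x2 * x3 / 2.
Proof using gram bracket.
have trq y0 y1 y2 y3 : \tr (quat y0 y1 y2 y3) = 2 * y0.
  rewrite (_ : quat _ _ _ _ = y0%:M + vsval (sl2_comb y1 y2 y3)).
    by rewrite mxtraceD mxtrace_scalar vsval_trace addr0 mulr_natl.
  by rewrite val_sl2_comb /quat raddf0 add0r.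
by rewrite det_mx2 -[quat _ _ _ _ * _]/(_ *m _) quat_mul !trq; field.
Qed.

Lemma lie_comb x1 x2 x3 y1 y2 y3 :
  lie (sl2_comb x1 x2 x3) (sl2_comb y1 y2 y3) =
  sl2_comb (x2 * y3 - x3 * y2) (x1 * y2 - x2 * y1) (x3 * y1 - x1 * y3).
Proof using gram bracket.
apply: val_inj; rewrite /= val_lie !val_sl2_comb !quat_mul !quatE.
move: (1 : 'M[R]_2) => I.
by apply/matrixP => i j; rewrite !mxE; field.
Qed.

End Frame.

(** * Geodesics and the Lax equation *)

Section Matrix2.
Context {R : realType}.
Implicit Types (X Y : 'M[R]_2) (g h : R -> 'M[R]_2) (J : set R).

Lemma mulmx_adj2 X : X *m ((\tr X)%:M - X) = (\det X)%:M.
Proof.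
rewrite det_mx2 /mxtrace; apply/matrixP => i j; rewrite !mxE !sum_ord2 !mxE !sum_ord2.
by case: (ord2E i) => ->; case: (ord2E j) => ->; rewrite /= ?mulr1n ?mulr0n; field.
Qed.

(** By Cayley-Hamilton, tr X - X is the adjugate. On matrices of determinant 1 the inverse is
    therefore a linear function of X, which makes it easy to differentiate. *)
Lemma invmx2 X : \det X = 1 -> invmx X = (\tr X)%:M - X.
Proof.
move=> X1; have Xu : X \in unitmx by rewrite unitmxE X1 unitr1.
by rewrite -[RHS](mulKmx Xu) mulmx_adj2 X1 mulmx1.
Qed.

Lemma is_derive_mxcst m n (X : 'M[R]_(m, n)) (t : R) :
  is_derive t 1 (fun _ : R => X) 0.
Proof.
by apply/is_derive_mxP => i j; rewrite mxE; exact: is_derive_fun_cst.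
Qed.

Lemma is_derive_mxtrace n (M : R -> 'M[R]_n) (t : R) (dM : 'M[R]_n) :
  is_derive t 1 M dM -> is_derive t 1 (fun s => \tr (M s)) (\tr dM).
Proof.
by move=> /is_derive_mxP dMij; apply: is_derive_fun_sum => i; exact: dMij.
Qed.

Lemma is_derive_mx_unique m n (M : R -> 'M[R]_(m, n)) (t : R) (X Y : 'M[R]_(m, n)) :
  is_derive t 1 M X -> is_derive t 1 M Y -> X = Y.
Proof. by move=> [_ <-] [_ <-]. Qed.

Lemma near_eq_is_derive_mx m n (M N : R -> 'M[R]_(m, n)) J (t : R) (X : 'M[R]_(m, n)) :
  open J -> J t -> (forall s, J s -> M s = N s) ->
  is_derive t 1 M X -> is_derive t 1 N X.
Proof.
move=> oJ Jt MN /is_derive_mxP dM; apply/is_derive_mxP => i j.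
apply: near_eq_is_derive (dM i j); apply: open_near_eq oJ Jt _ => s Js.
by rewrite MN.
Qed.

Lemma mx_interval_cst m n (M : R -> 'M[R]_(m, n)) J : is_interval J ->
  (forall t, J t -> is_derive t 1 M 0) -> forall s t, J s -> J t -> M s = M t.
Proof.
move=> iJ dM s t Js Jt; apply/matrixP => i j.
apply: (interval_cst (f := fun s => M s i j) iJ) => // x /dM/is_derive_mxP d.
by have := d i j; rewrite mxE.
Qed.

Section Invertible.
Variables (g : R -> 'M[R]_2) (J : set R) (oJ : open J).
Hypothesis g1 : forall t, J t -> \det (g t) = 1.

Lemma mx_unit2 t : J t -> g t \in unitmx.
Proof using g1. by move=> /g1 gt; rewrite unitmxE gt unitr1. Qed.

(** Differentiability comes from the linear formula [invmx2]; the value of the derivative comes from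
    differentiating the constant product of g and its inverse. *)
Lemma is_derive_invmx2 t (dg : 'M[R]_2) : J t -> is_derive t 1 g dg ->
  is_derive t 1 (fun s => invmx (g s)) (- (invmx (g t) *m dg *m invmx (g t))).
Proof using g1 oJ.
move=> Jt d.
pose i s := (\tr (g s))%:M - g s.
have gi s : J s -> i s = invmx (g s) by move=> Js; rewrite invmx2// g1.
have [di hi] : exists di, is_derive t 1 i di.
  exists ((\tr dg)%:M - dg); apply/is_derive_mxP => k l.
  have -> : (fun s => i s k l) = fun s => (\tr (g s)) * (k == l)%:R - g s k l.
    by apply/funext => s; rewrite !mxE mulr_natr.
  rewrite !mxE; apply: is_derive_funB; last exact: (is_derive_mxP _ _ _).1.
  apply: (is_derive_eq (is_derive_funM (is_derive_mxtrace d)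
    (is_derive_fun_cst _ t))).
  by rewrite mulr0 add0r mulr_natl.
have e : dg *m i t + g t *m di = 0.
  apply: (is_derive_mx_unique (is_derive_mulmx d hi)).
  apply: (near_eq_is_derive_mx oJ Jt _ (is_derive_mxcst 1%:M t)) => s Js.
  by rewrite gi// mulmxV// mx_unit2.
apply: (near_eq_is_derive_mx oJ Jt gi).
suff -> : - (invmx (g t) *m dg *m invmx (g t)) = di by [].
move/eqP: e; rewrite addrC addr_eq0 => /eqP/(congr1 (mulmx (invmx (g t)))).
by rewrite mulKmx ?mx_unit2// => ->; rewrite mulmxN -mulmxA gi.
Qed.

(** Jacobi's formula for a curve of constant determinant: the trace expression of det g is
    differentiated and compared with the derivative 0. *)
Lemma mxtrace_log_derivative t (dg : 'M[R]_2) : J t -> is_derive t 1 g dg ->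
  \tr (invmx (g t) *m dg) = 0.
Proof using g1 oJ.
move=> Jt d.
have dtr := is_derive_mxtrace d.
have dsq := is_derive_mxtrace (is_derive_mulmx d d).
have dd := is_derive_funM (is_derive_funB (is_derive_funM dtr dtr) dsq)
  (is_derive_fun_cst 2^-1 t).
have d1 : is_derive t 1 (fun s => (\tr (g s) * \tr (g s) - \tr (g s *m g s)) / 2) 0.
  apply: near_eq_is_derive (is_derive_fun_cst 1 t).
  apply: open_near_eq oJ Jt _ => s Js.
  by rewrite -expr2 -[_ *m _]/(_ * _) -det_mx2 g1.
have := etrans (esym (@derive_val _ _ _ _ _ _ _ dd)) (@derive_val _ _ _ _ _ _ _ d1).
rewrite invmx2 ?g1// mulmxBl linearB/= mul_scalar_mx linearZ/= mxtraceD.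
by rewrite (mxtrace_mulC dg) mulr0 add0r => e; rewrite -[RHS]e; field.
Qed.

End Invertible.

(** Two curves with the same left logarithmic derivative differ by a left translation, because g
    h^-1 has derivative 0. *)
Lemma log_derivative_unique g h J (x : R -> 'M[R]_2) t0 :
  open_interval J -> J t0 ->
  (forall t, J t -> \det (g t) = 1) -> (forall t, J t -> \det (h t) = 1) ->
  (forall t, J t -> is_derive t 1 g (g t *m x t)) ->
  (forall t, J t -> is_derive t 1 h (h t *m x t)) ->
  forall t, J t -> g t = g t0 *m invmx (h t0) *m h t.
Proof.
move=> [oJ iJ _] Jt0 g1 h1 dg dh t Jt.
have hu s (Js : J s) : h s \in unitmx := mx_unit2 h1 Js.
rewrite (mx_interval_cst (M := fun s => g s *m invmx (h s)) iJ _ Jt0 Jt) ?mulmxKV ?hu//.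
move=> s Js.
apply: (is_derive_eq (is_derive_mulmx (dg s Js)
  (is_derive_invmx2 oJ h1 Js (dh s Js)))).
by rewrite mulKmx ?hu// mulmxN mulmxA subrr.
Qed.

End Matrix2.

(** * From geodesics to Lax curves and back *)

Section Geodesics.
Context {R : realType} (v1 v2 v3 : sl2 R).
Hypothesis frame : basis_of {: sl2 R} [:: v1; v2; v3].
Hypothesis gram :
  [/\ half_killing v1 v1 = 1, half_killing v2 v3 = 1, half_killing v1 v2 = 0
    & [/\ half_killing v1 v3 = 0, half_killing v2 v2 = 0 & half_killing v3 v3 = 0]].
Hypothesis bracket : [/\ lie v1 v2 = v2, lie v1 v3 = - v3 & lie v2 v3 = v1].
Context (q : sl2 R -> sl2 R -> R) (Phi : 'End(sl2 R)) (lambda mu zeta : R).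
Hypothesis qC : forall x y, q x y = q y x.
Hypothesis PhiP : associated_iso q Phi.
Hypothesis PhiE : [/\ Phi v1 = mu *: v1, Phi v2 = lambda *: v2
  & Phi v3 = zeta *: v2 + lambda *: v3].

Local Notation comb := (sl2_comb v1 v2 v3).
Local Notation quat := (quat v1 v2 v3).
Local Notation combE := (half_killing_comb gram).
Local Notation eta := mu^-1.
Local Notation nu := lambda^-1.
Local Notation a := (eta - nu).
Local Notation b := (zeta * nu ^+ 2).
Local Notation E := (lax_field a b).

Lemma Phi_inj : injective Phi.
Proof using PhiP. by have [/eqP/lker0P] := PhiP. Qed.

Lemma mu_neq0 : mu != 0.
Proof using PhiE PhiP gram.
have [p1 _ _] := PhiE; have [h11 _ _ _] := gram.
apply: contraTneq isT => mu0; move: p1; rewrite mu0 scale0r -(linear0 Phi).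
move=> /Phi_inj v10; move: h11.
by rewrite v10 -(scale0r 0) half_killingZl mul0r => /eqP; rewrite eq_sym oner_eq0.
Qed.

Lemma lambda_neq0 : lambda != 0.
Proof using PhiE PhiP gram.
have [_ p2 _] := PhiE; have [_ h23 _ _] := gram.
apply: contraTneq isT => l0; move: p2; rewrite l0 scale0r -(linear0 Phi).
move=> /Phi_inj v20; move: h23.
by rewrite v20 -(scale0r 0) half_killingZl mul0r => /eqP; rewrite eq_sym oner_eq0.
Qed.

Lemma Phi_comb x1 x2 x3 :
  Phi (comb x1 x2 x3) = comb (mu * x1) (lambda * x2 + zeta * x3) (lambda * x3).
Proof using PhiE.
have [p1 p2 p3] := PhiE.
rewrite /sl2_comb !linearD/= !linearZ/= p1 p2 p3 scalerDr !scalerA.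
by rewrite (mulrC mu) !(mulrC lambda) (mulrC zeta) scalerDl !addrA.
Qed.

Lemma combN x1 x2 x3 : - comb x1 x2 x3 = comb (- x1) (- x2) (- x3).
Proof. by rewrite /sl2_comb !opprD !scaleNr. Qed.

(** This is Phi^-1 of the element with coordinates z; the entry b arises from Phi^-1 v3 = nu v3 -
    zeta nu^2 v2. *)
Definition Phi_inv_comb (z : 'rV[R]_3) : sl2 R :=
  comb (eta * z 0 0) (nu * z 0 1 - b * z 0 2) (nu * z 0 2).

Lemma Phi_inv_combK z : Phi (Phi_inv_comb z) = comb (z 0 0) (z 0 1) (z 0 2).
Proof using PhiE PhiP gram.
have m0 := mu_neq0; have l0 := lambda_neq0; rewrite Phi_comb.
by apply: eq_comb; field; rewrite ?m0 ?l0.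
Qed.

Lemma lax_field_lie z : let u := E z in
  lie (comb (z 0 0) (z 0 1) (z 0 2)) (Phi_inv_comb z) =
  comb (u 0 0) (u 0 1) (u 0 2).
Proof using PhiE PhiP gram bracket.
rewrite /= lax_fieldE !row3E (lie_comb gram bracket).
have m0 := mu_neq0; have l0 := lambda_neq0.
by apply: eq_comb; field; rewrite ?l0 ?m0.
Qed.

(* By Koszul's formula, [q (D x x) y = - q x (lie x y)], and the
   half Killing form is ad-invariant. *)
Lemma Phi_levi_civita (D : sl2 R -> sl2 R -> sl2 R) x :
  levi_civita q D -> Phi (D x x) = - lie (Phi x) x.
Proof using PhiP frame gram qC.
move=> [_ _ torsion compat].
have [_ _ qE] := PhiP.
have qDl x1 x2 y : q (x1 + x2) y = q x1 y + q x2 y.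
  by rewrite !qE linearD half_killingDl.
have qx y : half_killing (Phi (D x x)) y = - half_killing (lie (Phi x) x) y.
  have e1 := compat x x y.
  have e2 : q (D y x) x = 0.
    by have := compat y x x; rewrite (qC x) => e; lra.
  have e3 : q (D x y) x = q (lie x y) x.
    by have := qDl (lie x y) (D y x) x; rewrite -{1}torsion subrK e2 addr0.
  rewrite -qE -half_killing_lie -qE (qC x (lie x y)) -e3 (qC _ x).
  by apply/eqP; rewrite -addr_eq0 e1.
rewrite [LHS](sl2_combE frame gram) [in RHS](sl2_combE frame gram (lie (Phi x) x)).
by rewrite combN !qx.
Qed.

Lemma is_derive_half_killing (x : R -> sl2 R) (t : R) (d v : sl2 R) :
  is_derive t 1 (fun s => vsval (x s)) (vsval d) ->
  is_derive t 1 (fun s => half_killing (x s) v) (half_killing d v).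
Proof.
move=> dx; apply: is_derive_funZ; apply: is_derive_mxtrace.
apply: (is_derive_eq (is_derive_mulmx dx (is_derive_mxcst (vsval v) t))).
by rewrite mulmx0 addr0.
Qed.

Lemma is_derive_quat (f0 f1 f2 f3 : R -> R) (t d0 d1 d2 d3 : R) :
  is_derive t 1 f0 d0 -> is_derive t 1 f1 d1 -> is_derive t 1 f2 d2 ->
  is_derive t 1 f3 d3 ->
  is_derive t 1 (fun s => quat (f0 s) (f1 s) (f2 s) (f3 s)) (quat d0 d1 d2 d3).
Proof.
move=> h0 h1 h2 h3; apply/is_derive_mxP => i j.
have quatE x0 x1 x2 x3 : quat x0 x1 x2 x3 i j = x0 * (i == j)%:R +
    (x1 * vsval v1 i j + x2 * vsval v2 i j + x3 * vsval v3 i j).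
  by rewrite !mxE mulr_natr.
rewrite quatE (_ : (fun s => _) = fun s => f0 s * (i == j)%:R + (f1 s * vsval v1 i j
  + f2 s * vsval v2 i j + f3 s * vsval v3 i j)); last by apply/funext => s.
have h (f : R -> R) (d k : R) :
    is_derive t 1 f d -> is_derive t 1 (fun s => f s * k) (d * k).
  move=> hf; apply: (is_derive_eq (is_derive_funM hf (is_derive_fun_cst k t))).
  by rewrite mulr0 add0r mulrC.
exact: (is_derive_funD (h _ _ _ h0)
  (is_derive_funD (is_derive_funD (h _ _ _ h1) (h _ _ _ h2)) (h _ _ _ h3))).
Qed.

Lemma lax_curveK (g : R -> 'M[R]_2) t :
  velocity g t = Phi_inv_comb (lax_curve Phi v1 v2 v3 g t).
Proof using PhiE PhiP frame gram.
apply: Phi_inj; rewrite Phi_inv_combK [LHS](sl2_combE frame gram).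
by rewrite /lax_curve [in RHS](sl2_combE frame gram (Phi _)) (coord_combE frame) !row3E.
Qed.

(** With x the velocity and z = Phi x, the geodesic equation x' = - D_x x gives z' = - Phi (D_x x) =
    [Phi x, x] = [z, Phi^-1 z], which is the Lax field. *)
Lemma geodesic_lax (g : R -> 'M[R]_2) J : geodesic q g J ->
  integral_curve E (lax_curve Phi v1 v2 v3 g) J.
Proof using PhiE PhiP frame gram bracket qC.
move=> [oJ [D LC geo]]; split=> // t Jt; have [_ _ dv] := geo t Jt.
set x := velocity g t in dv *.
set z := lax_curve Phi v1 v2 v3 g t.
have xE : x = Phi_inv_comb z := lax_curveK g t.
have vN : vsval (- D x x) = - vsval (D x x) by rewrite linearN.
rewrite -vN in dv.
have PD : Phi (- D x x) = comb (E z 0 0) (E z 0 1) (E z 0 2).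
  by rewrite linearN/= (Phi_levi_civita x LC) opprK xE Phi_inv_combK lax_field_lie.
(* Self-adjointness moves Phi onto the fixed vector v, so that only the derivative of the velocity
   as a matrix curve is used. *)
have dPhi v : is_derive t 1 (fun s => half_killing (Phi (velocity g s)) v)
    (half_killing (Phi (- D x x)) v).
  have [_ sa _] := PhiP; rewrite sa (_ : (fun s => _) = fun s =>
    half_killing (velocity g s) (Phi v)); last by apply/funext => s; rewrite sa.
  exact: is_derive_half_killing dv.
rewrite (_ : lax_curve Phi v1 v2 v3 g = fun s =>
  row3 (half_killing (Phi (velocity g s)) v1) (half_killing (Phi (velocity g s)) v3)
    (half_killing (Phi (velocity g s)) v2)); last first.
  apply/funext => s; rewrite /lax_curve.
  by rewrite [in LHS](sl2_combE frame gram (Phi _)) (coord_combE frame).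
rewrite -/z [E z]row3_eta.
have [e1 e3 e2] := combE (E z 0 0) (E z 0 1) (E z 0 2).
rewrite -{1}e1 -{2}e2 -{3}e3 -PD.
by apply: is_derive_row3; exact: dPhi.
Qed.

Lemma velocity_left_log (h : R -> 'M[R]_2) t (x : sl2 R) :
  \det (h t) = 1 -> is_derive t 1 h (h t *m vsval x) -> velocity h t = x.
Proof.
move=> h1 [_ dh]; rewrite /velocity derive1E dh mulKmx ?vsvalK//.
by rewrite unitmxE h1 unitr1.
Qed.

(** The velocity of h is Phi^-1 z, and applying the injective map Phi turns the geodesic equation
    into the Lax equation. The connection is an argument; [maximal_geodesic_interval] takes it from
    the given geodesic. *)
Lemma geodesic_of_lax (D : sl2 R -> sl2 R -> sl2 R) (h : R -> 'M[R]_2) z J :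
  levi_civita q D -> integral_curve E z J ->
  (forall t, J t -> \det (h t) = 1) ->
  (forall t, J t -> is_derive t 1 h (h t *m vsval (Phi_inv_comb (z t)))) ->
  geodesic q h J.
Proof using PhiE PhiP frame gram bracket qC.
move=> LC hz h1 dh; have [oJ _] := hz; split => //; exists D => // t Jt.
split; [exact: h1|by have [] := dh t Jt|].
have vE s : J s -> velocity h s = Phi_inv_comb (z s).
  by move=> Js; apply: velocity_left_log; [exact: h1|exact: dh].
apply: (near_eq_is_derive_mx (M := fun s => vsval (Phi_inv_comb (z s))) _ Jt).
- by have [] := oJ.
- by move=> s Js; rewrite vE.
have [d1 d2 d3] := lax_curve_derive hz Jt.
have -> : - vsval (D (velocity h t) (velocity h t)) = vsval (Phi_inv_comb (E (z t))).
  have <- : vsval (- D (velocity h t) (velocity h t)) =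
      - vsval (D (velocity h t) (velocity h t)) by rewrite linearN.
  congr vsval; apply: Phi_inj; rewrite linearN/=.
  rewrite (Phi_levi_civita _ LC) opprK vE// !Phi_inv_combK.
  by rewrite lax_field_lie.
rewrite (_ : (fun s => _) = fun s => quat 0 (eta * z s 0 0)
  (nu * z s 0 1 - b * z s 0 2) (nu * z s 0 2)); last first.
  by apply/funext => s; rewrite val_sl2_comb.
rewrite val_sl2_comb lax_fieldE !row3E.
exact: (is_derive_quat (is_derive_fun_cst 0 t) (is_derive_funZ eta d1)
  (is_derive_funB (is_derive_funZ nu d2) (is_derive_funZ b d3))
  (is_derive_funZ nu d3)).
Qed.

(** The projection [vsproj] inside [velocity] loses nothing, since the logarithmic derivative of a
    curve of determinant 1 has trace 0. *)
Lemma geodesic_log_derivative (g : R -> 'M[R]_2) J t : geodesic q g J -> J t ->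
  is_derive t 1 g (g t *m vsval (velocity g t)).
Proof.
move=> [[oJ _ _] [D _ geo]] Jt; have [g1 dg _] := geo t Jt.
have gJ s : J s -> \det (g s) = 1 by move=> /geo[].
have d := derivableP dg.
rewrite /velocity vsprojK ?derive1E ?mulKVmx//.
  by rewrite unitmxE g1 unitr1.
by rewrite mem_sl2 (mxtrace_log_derivative oJ gJ Jt d).
Qed.

(** On J, g and h have the same logarithmic derivative, so a left translate of h agrees with g on J.
    This translate is a geodesic on all of I, and maximality of g gives I = J. *)
Lemma maximal_geodesic_interval (g h : R -> 'M[R]_2) (J I : set R) z :
  maximal_on (geodesic q) g J -> integral_curve E z I -> J `<=` I ->
  (forall t, J t -> lax_curve Phi v1 v2 v3 g t = z t) ->
  (forall t, I t -> \det (h t) = 1) ->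
  (forall t, I t -> is_derive t 1 h (h t *m vsval (Phi_inv_comb (z t)))) ->
  I = J.
Proof using PhiE PhiP frame gram bracket qC.
move=> [geo max] hz JI gz h1 dh.
have [oJ [D LC geoJ]] := geo.
have [_ _ [t0 Jt0]] := oJ.
have g1 s : J s -> \det (g s) = 1 by move=> /geoJ[].
apply: (max (fun t => g t0 *m invmx (h t0) *m h t)) => //.
- apply: (geodesic_of_lax LC hz) => t It.
    by rewrite !det_mulmx det_inv g1// !h1 ?invr1 ?mulr1//; exact: JI.
  apply: (is_derive_eq (is_derive_mulmx (is_derive_mxcst _ t) (dh t It))).
  by rewrite mul0mx add0r mulmxA.
- move=> t Jt; apply/esym.
  apply: (log_derivative_unique (x := fun s => vsval (velocity g s))
    oJ Jt0 g1 _ _ _ Jt).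
  + by move=> s /JI; exact: h1.
  + by move=> s Js; exact: (geodesic_log_derivative geo Js).
  + by move=> s Js; rewrite lax_curveK gz//; apply: dh; exact: JI.
Qed.

(* With [P = exp(w v1) exp(u v2)], the conjugate [Z0 = P z P^-1] is constant
   along the Lax flow and [exp(nu t Z0) P] has logarithmic derivative
   [nu z + a z1 v1 - b z3 v2 = Phi^-1 z]. *)
Lemma lax_lift (z : R -> 'rV[R]_3) (I : set R) (w u : R -> R) (c1 c2 c3 : R) :
  (forall t, I t -> is_derive t 1 w (a * z t 0 0)) ->
  (forall t, I t -> is_derive t 1 u (- b * z t 0 2 - a * z t 0 0 * u t)) ->
  (forall t, I t -> let e := expR (w t / 2) in let f := expR (- (w t / 2)) in
    let P := quat ((e + f) / 2) (e - f) (e * u t) 0 in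
    P *m quat 0 (z t 0 0) (z t 0 1) (z t 0 2) = quat 0 c1 c2 c3 *m P) ->
  exists h : R -> 'M[R]_2, forall t, I t -> \det (h t) = 1 /\
    is_derive t 1 h (h t *m vsval (Phi_inv_comb (z t))).
Proof using PhiE PhiP gram bracket.
move=> dw du conj.
(* For Z0 with coordinates c1, c2, c3, the square of Z0 is k times the identity, so exp(s Z0) =
   [gcosh k s] + [gsinh k s] Z0; X below is exp(nu t Z0). *)
pose k := c1 ^+ 2 / 4 + c2 * c3 / 2.
pose C t := gcosh k (nu * t); pose S t := gsinh k (nu * t).
pose X t := quat (C t) (S t * c1) (S t * c2) (S t * c3).
pose e t := expR (w t / 2); pose f t := expR (- (w t / 2)).
(* As v1^2 = 1/4, v2^2 = 0 and v1 v2 = v2 / 2, this is the product of exp(w v1) and exp(u v2). *)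
pose P t := quat ((e t + f t) / 2) (e t - f t) (e t * u t) 0.
have ef t : e t * f t = 1 by rewrite -expRD subrr expR0.
exists (fun t => X t *m P t) => t It; split.
  rewrite det_mulmx !(det_quat gram bracket).
  have CS := gcosh2Bsinh2 k (nu * t); rewrite -/(C t) -/(S t) in CS.
  transitivity ((C t ^+ 2 - k * S t ^+ 2) * (e t * f t)).
    by rewrite /k; field.
  by rewrite ef CS mulr1.
have dC : is_derive t 1 C (nu * (k * S t)).
  apply: (is_derive_eq (is_derive_fun_comp (is_derive_gcosh k _) (is_derive_mull nu t))).
  by rewrite mulrC.
have dS : is_derive t 1 S (nu * C t).
  apply: (is_derive_eq (is_derive_fun_comp (is_derive_gsinh k _) (is_derive_mull nu t))).
  by rewrite mulrC.
have dw2 : is_derive t 1 (fun s => w s / 2) (a * z t 0 0 / 2).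
  apply: (is_derive_eq (is_derive_funM (dw t It) (is_derive_fun_cst 2^-1 t))).
  by rewrite mulr0 add0r mulrC.
have de : is_derive t 1 e (e t * (a * z t 0 0 / 2)).
  exact: (is_derive_fun_comp (g := fun s => w s / 2) (is_derive_expR _) dw2).
have df : is_derive t 1 f (f t * (- (a * z t 0 0 / 2))).
  exact: (is_derive_fun_comp (g := fun s => - (w s / 2)) (is_derive_expR _)
    (is_derive_funN dw2)).
have dcst c := is_derive_fun_cst c t.
have dX := is_derive_quat dC (is_derive_funM dS (dcst c1))
  (is_derive_funM dS (dcst c2)) (is_derive_funM dS (dcst c3)).
have dP := is_derive_quat (is_derive_funM (is_derive_funD de df) (dcst 2^-1))
  (is_derive_funB de df) (is_derive_funM de (du t It)) (dcst 0).
apply: (is_derive_eq (is_derive_mulmx dX dP)).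
have -> : quat (nu * (k * S t)) (S t * 0 + c1 * (nu * C t))
    (S t * 0 + c2 * (nu * C t)) (S t * 0 + c3 * (nu * C t)) =
    nu *: (X t *m quat 0 c1 c2 c3).
  rewrite /X (quat_mul gram bracket) quatZ.
  by apply: eq_quat; rewrite /k; field; rewrite lambda_neq0.
(* The relation P z = Z0 P moves the factor Z0 coming from X' to the right of P, where it becomes
   z. *)
rewrite -scalemxAl -mulmxA -conj// -/(e t) -/(f t) -/(P t) scalemxAr -mulmxDr -mulmxA.
congr (_ *m _).
have -> : vsval (Phi_inv_comb (z t)) = nu *: quat 0 (z t 0 0) (z t 0 1) (z t 0 2)
    + quat 0 (a * z t 0 0) (- (b * z t 0 2)) 0.
  by rewrite val_sl2_comb quatZ quatD; apply: eq_quat; ring.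
rewrite [RHS]mulmxDr -scalemxAr; congr (_ + _).
have m0 := mu_neq0; have l0 := lambda_neq0.
by rewrite /P (quat_mul gram bracket); apply: eq_quat; field; rewrite ?l0 ?m0.
Qed.

Lemma is_derive_expRM (k t0 t : R) : is_derive t 1
  (fun s => expR (- (k * (s - t0)))) (- k * expR (- (k * (t - t0)))).
Proof.
have d := is_derive_funN (is_derive_funZ k (is_derive_shiftB t0 t)).
apply: (is_derive_eq (is_derive_fun_comp (g := fun s => - (k * (s - t0)))
  (is_derive_expR _) d)).
by rewrite mulr1 mulrC.
Qed.

(** On the plane z3 = 0 the first coordinate is a constant A and z2' = - a A z2, so the Lax curve
    extends to the whole line. Lifting the extension and using maximality gives a complete
    geodesic. *)
Lemma geodesic_z3_zero (g : R -> 'M[R]_2) J t0 :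
  maximal_on (geodesic q) g J -> J t0 ->
  lax_curve Phi v1 v2 v3 g t0 0 2 = 0 -> J = setT.
Proof using PhiE PhiP frame gram bracket qC.
move=> max Jt0 z30; have [geo _] := max.
have hz := geodesic_lax geo; have [[_ iJ _] _] := hz.
set z := lax_curve Phi v1 v2 v3 g in z30 hz.
have z3J t : J t -> z t 0 2 = 0 by exact: (lax_z3_zero hz Jt0 z30).
have dz := lax_curve_derive hz.
pose A : R := z t0 0 0; pose B : R := z t0 0 1.
have z1J t : J t -> z t 0 0 = A.
  move=> Jt; apply: (interval_cst (f := fun s => z s 0 0) iJ) => // s Js.
  by have [d1 _ _] := dz _ Js; apply: (is_derive_eq d1); rewrite z3J// expr0n mulr0.
pose F t := B * expR (- (a * A * (t - t0))).
have dF (t : R) : is_derive t 1 F (- (a * A) * F t).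
  apply: (is_derive_eq (is_derive_funZ B (is_derive_expRM (a * A) t0 t))).
  by rewrite mulrCA.
have z2J t : J t -> z t 0 1 = F t.
  move=> Jt; apply/eqP; rewrite -subr_eq0; apply/eqP.
  apply: (linear_ode_zero (h := fun=> - (a * A))
    (y := fun s => z s 0 1 - F s) iJ _ _ Jt0 _ Jt).
  - by move=> s _; exact: cst_continuous.
  - move=> s Js; have [_ d2 _] := dz _ Js.
    apply: (is_derive_eq (is_derive_funB d2 (dF s))).
    by rewrite z3J// z1J//; ring.
  - by rewrite /F subrr mulr0 oppr0 expR0 mulr1 subrr.
pose zz t := row3 A (F t) 0.
have hzz : integral_curve E zz setT.
  split; first by split; [exact: openT|by []|by exists 0].
  move=> t _; rewrite lax_fieldE !row3E.
  apply: is_derive_row3; rewrite ?expr0n ?mulr0;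
    [exact: is_derive_fun_cst| |exact: is_derive_fun_cst].
  by apply: (is_derive_eq (dF t)); ring.
(* Here u = 0 because z3 = 0, and w vanishes at t0; thus P is the identity at t0 and the constant Z0
   is the value of the Lax curve there. *)
have [|||h hh] := @lax_lift zz setT (fun t => a * A * (t - t0)) (fun=> 0) A B 0.
- move=> t _; rewrite row3E.
  by apply: (is_derive_eq (is_derive_funZ (a * A) (is_derive_shiftB t0 t))); rewrite mulr1.
- by move=> t _; rewrite row3E !mulr0 subr0; exact: is_derive_fun_cst.
- move=> t _; rewrite !row3E /=.
  have ef := expRxMexpNx_1 (a * A * (t - t0) / 2).
  have FE : F t = B * expR (- (a * A * (t - t0) / 2)) ^+ 2.
    by rewrite /F -expRM_natl; congr (_ * expR _); field; rewrite ?mu_neq0 ?lambda_neq0.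
  rewrite FE !(quat_mul gram bracket); move: ef.
  move: (expR (- _)) (expR _) => f e ef.
  apply: eq_quat; try by field.
  transitivity (B * f * (e * f)); first by field.
  by rewrite ef; field.
apply/esym; apply: (maximal_geodesic_interval (h := h) max hzz).
- by [].
- by move=> t Jt; rewrite -/z [z t]row3_eta z1J// z2J// z3J.
- by move=> t /hh[].
- by move=> t /hh[].
Qed.

(** The explicit solution [lax_row] continues the Lax curve wherever the denominator D is positive,
    and it lifts to the group there. Hence a maximal geodesic cannot stop before D vanishes. *)
Lemma geodesic_z3_neq0 (g : R -> 'M[R]_2) J I t0 : 0 < a * b ->
  maximal_on (geodesic q) g J -> J t0 ->
  let A : R := lax_curve Phi v1 v2 v3 g t0 0 0 in
  let B : R := lax_curve Phi v1 v2 v3 g t0 0 2 in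
  B != 0 -> open_interval I -> J `<=` I ->
  (forall t, I t -> 0 < lax_den a b A B (t - t0)) -> I = J.
Proof using PhiE PhiP frame gram bracket qC.
move=> ab0 max Jt0 A B B0 oI JI D0; have [geo _] := max.
have a_neq0 := lax_a_neq0 ab0.
have hz := geodesic_lax geo.
pose k := A ^+ 2 + 2 * lax_curve Phi v1 v2 v3 g t0 0 1 * B.
have zJ t : J t -> lax_curve Phi v1 v2 v3 g t = lax_row a b t0 A B k t.
  by move=> /(lax_solE ab0 hz Jt0 B0)[].
have D_neq0 t : I t -> lax_den a b A B (t - t0) != 0 by move=> /D0/gt_eqF->.
have hI := lax_row_integral ab0 k B0 oI D_neq0.
pose D t := lax_den a b A B (t - t0); pose D' t := lax_dden a b A B (t - t0).
have dD (t : R) : is_derive t 1 D (D' t) := is_derive_lax_den a b A B t0 t.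
have dD' (t : R) : is_derive t 1 D' (lax_k a b A B * D t).
  exact: is_derive_lax_dden.
(* Since a z1 = - D' / D, a primitive is - ln D. The initial value u(t0) = - A / B removes the v1
   component of Z0, whose other coordinates are B and, by the Casimir value k, k / (2 B). *)
have [|||h hh] := @lax_lift (lax_row a b t0 A B k) I (fun t => - ln (D t))
  (fun t => D' t / (a * B)) 0 (k / (2 * B)) B.
- move=> t It; rewrite row3E /lax_sol /= -/(D t) -/(D' t).
  apply: (is_derive_eq (is_derive_funN (is_derive_fun_comp (g := D)
    (is_derive1_ln (D0 _ It)) (dD t)))).
  rewrite -/(D t); move: a_neq0 (D_neq0 _ It : D t != 0).
  move: (D t) (D' t) (a) => d d' a' a0 d0.
  by field; rewrite a0 d0.
- move=> t It; rewrite !row3E /lax_sol /= -/(D t) -/(D' t).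
  apply: (is_derive_eq (is_derive_funM (dD' t) (is_derive_fun_cst (a * B)^-1 t))).
  have e := lax_dden_sqr a b A B (t - t0); rewrite -/(D t) -/(D' t) in e.
  have Dt : D t != 0 := D_neq0 _ It.
  move: e Dt a_neq0.
  move: (b) (a) (lax_k a b A B) (D' t) (D t) => b' a' k' d' d e d0 a0.
  have -> : b' = (d' ^+ 2 - k' * d ^+ 2) / (a' * B ^+ 2).
    by rewrite e; field; rewrite B0 a0.
  by field; rewrite B0 a0 d0.
- move=> t It; rewrite !row3E /lax_sol /= -/(D t) -/(D' t).
  have ef := expRxMexpNx_1 (- ln (D t) / 2).
  (* The factor f is the square root of D and e is its inverse; in terms of f the conjugation
     relation is rational. *)
  have fE : expR (- (- ln (D t) / 2)) ^+ 2 = D t.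
    by rewrite -expRM_natl -[RHS]lnK ?posrE; [congr expR; field|exact: D0].
  rewrite !(quat_mul gram bracket); move: ef fE a_neq0.
  have : expR (- (- ln (D t) / 2)) != 0 by rewrite gt_eqF// expR_gt0.
  move: (expR _) (expR (- _)) => e f f0 ef <-.
  move: (D' t) (a) => d' a' a0.
  have -> : e = f^-1 by rewrite -[LHS](mulfK f0) ef mul1r.
  by apply: eq_quat; field; rewrite ?B0 ?f0 ?a0.
apply: (maximal_geodesic_interval (h := h) max hI JI).
- exact: zJ.
- by move=> t /hh[].
- by move=> t /hh[].
Qed.

End Geodesics.

(** * The projected foliation *)

Section ProjectivePlane.
Local Open Scope quotient_scope.
Context {R : realType}.
Implicit Types (u v : punctured R) (A U L : set 'rV[R]_3).

Lemma punctured_neq0 u : set_val u != 0.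
Proof. by have /set_mem := valP u. Qed.

Lemma rp2_pi_eqP u v :
  rp2_pi u = rp2_pi v <-> exists2 l : R, l != 0 & set_val u = l *: set_val v.
Proof.
split=> [/eqmodP/andP[/sub_rVP[l ul] _]|[l l0 ul]].
  exists l => //; apply: contraNneq (punctured_neq0 u) => l0.
  by rewrite ul l0 scale0r.
apply/eqmodP; apply/andP; split; apply/sub_rVP; first by exists l.
by exists l^-1; rewrite ul scalerA mulVf// scale1r.
Qed.

(** Invariance under nonzero scalars is what makes membership of a projective point independent of
    its representative. *)
Definition cone A := forall (l : R) z, l != 0 -> A z -> A (l *: z).

Lemma mem_proj_image A u : cone A -> proj_image A (rp2_pi u) <-> A (set_val u).
Proof.
move=> cA; split=> [[v Av /esym/rp2_pi_eqP[l l0 ->]]|Au]; first exact: cA.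
by exists u.
Qed.

Lemma proj_image_subP A L : cone A -> ~ L 0 ->
  proj_image L `<=` proj_image A <-> L `<=` A.
Proof.
move=> cA L0; split=> [LA z Lz|LA _ [u Lu <-]]; last first.
  by apply/(mem_proj_image _ cA); exact: LA.
have z0 : z \in punctured R.
  by apply/mem_set; apply: contra_notN L0 => /eqP <-.
pose u : punctured R := Sub z z0.
have : proj_image A (rp2_pi u) by apply: LA; exists u.
by move/(mem_proj_image _ cA).
Qed.

Lemma cone_line : cone [set z : 'rV[R]_3 | z 0 2 = 0].
Proof. by move=> l z _ /= z3; rewrite mxE z3 mulr0. Qed.

Lemma cone_strip (r : R) :
  cone [set z : 'rV[R]_3 | z 0 2 != 0 /\ - r < z 0 0 / z 0 2 < r].
Proof.
move=> l z l0 /= [z3 zr]; rewrite !mxE mulf_neq0//; split => //.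
by rewrite -mulf_div divff// mul1r.
Qed.

(** The image of an open cone is open in the quotient topology, because its preimage is the cone
    itself without the origin. Convergence in RP(2) thus gives open homogeneous conditions on
    representatives. *)
Lemma rp2_cvg_cone (T : Type) (F : set_system T) {FF : Filter F}
    (c : T -> punctured R) u U :
  cone U -> open U -> U (set_val u) ->
  (fun t => rp2_pi (c t)) @ F --> rp2_pi u -> \forall t \near F, U (set_val (c t)).
Proof.
move=> cU oU Uu cvg.
have piU : @rp2_pi R @^-1` proj_image U = set_val @^-1` U.
  by apply/seteqP; split=> v /= /(mem_proj_image _ cU).
have oV : open (proj_image U : set (RP2 R)).
  rewrite /open /= /quotient_open -[X in X @^-1` _]/(@rp2_pi R) piU.
  by exists U.
have : nbhs (rp2_pi u) (proj_image U).
  by apply: open_nbhs_nbhs; split => //; exact/mem_proj_image.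
move=> /cvg h; apply: (filterS (P := (fun t => rp2_pi (c t)) @^-1` proj_image U)).
  by move=> t /= /(mem_proj_image _ cU).
exact: h.
Qed.

Lemma affine_point_continuous (X Y : R -> R) (dX dY : R -> R) :
  (forall t : R, is_derive t 1 X (dX t)) -> (forall t : R, is_derive t 1 Y (dY t)) ->
  continuous (fun t => affine_point (X t) (Y t)).
Proof.
move=> hX hY.
pose f : R -> punctured R := fun t =>
  Sub (affine_row (X t) (Y t)) (affine_row_punctured (X t) (Y t)).
have cf : continuous f.
  apply: continuous_comp_initial => t.
  have := is_derive_row3 (hX t) (hY t) (is_derive_fun_cst 1 t).
  by move=> [/derivable1_diffP/differentiable_continuous ].
move=> t; apply: (@continuous_comp _ _ _ f (@rp2_pi R)); first exact: cf.
exact: pi_continuous.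
Qed.

End ProjectivePlane.

(** * Limits at the two ends of an open interval *)

Section Ends.
Context {R : realType}.

Lemma upper_end_cvg (T : topologicalType) (f h : R -> T) (s t : R) : s < t ->
  (forall x, s < x < t -> h x = f x) -> {for t, continuous f} ->
  h @ upper_end `]s, t[%classic --> f t.
Proof.
move=> st hf cf V /cf; rewrite /= => -[e /= e0 eV].
(* The time m must be within e of t and still inside the interval; when t - e / 2 is not to the
   right of s, the midpoint serves. *)
have [m [sm mt tm]] : exists m, [/\ s < m, m < t & t < m + e].
  have [se|es] := ltP s (t - e / 2).
    by exists (t - e / 2); split; lra.
  by exists ((s + t) / 2); split; lra.
exists m => /=; first by rewrite in_itv/= sm mt.
move=> x /=; rewrite in_itv/= => -[/andP[sx xt] mx].
rewrite hf ?sx//; apply: eV => /=.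
by rewrite gtr0_norm ?subr_gt0//; lra.
Qed.

Lemma lower_end_cvg (T : topologicalType) (f h : R -> T) (s t : R) : s < t ->
  (forall x, s < x < t -> h x = f x) -> {for s, continuous f} ->
  h @ lower_end `]s, t[%classic --> f s.
Proof.
move=> st hf cf V /cf; rewrite /= => -[e /= e0 eV].
have [m [sm mt tm]] : exists m, [/\ s < m, m < t & m < s + e].
  have [se|es] := ltP (s + e / 2) t.
    by exists (s + e / 2); split; lra.
  by exists ((s + t) / 2); split; lra.
exists m => /=; first by rewrite in_itv/= sm mt.
move=> x /=; rewrite in_itv/= => -[/andP[sx xt] mx].
rewrite hf ?sx//; apply: eV => /=.
by rewrite ltr0_norm ?subr_lt0//; lra.
Qed.

Lemma upper_end_filter (J : set R) : J !=set0 -> ProperFilter (upper_end J).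
Proof.
move=> J0; apply: filter_from_proper; last by move=> s Js; exists s.
apply: filter_from_filter => // s t Js Jt.
exists (Num.max s t); first by case: (leP s t).
by move=> x /= [Jx]; rewrite ge_max => /andP[sx tx].
Qed.

Lemma lower_end_filter (J : set R) : J !=set0 -> ProperFilter (lower_end J).
Proof.
move=> J0; apply: filter_from_proper; last by move=> s Js; exists s.
apply: filter_from_filter => // s t Js Jt.
exists (Num.min s t); first by case: (leP s t).
by move=> x /= [Jx]; rewrite le_min => /andP[sx tx].
Qed.

Lemma filter_from_near (J : set R) (B : R -> set R) (P : set R) :
  (forall s, J s -> B s s) -> filter_from J B P -> exists2 s, J s & P s.
Proof. by move=> JB [s Js BP]; exists s => //; apply: BP; exact: JB. Qed.

End Ends.

(** * The strip and the leaves joining p1 and p2 *)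

Section Leaves.
Context {R : realType} (a b : R).
Hypothesis ab0 : 0 < a * b.
Implicit Types (J : set R) (t : R).

Local Notation E := (lax_field a b).
Local Notation r := (Num.sqrt (b / a)).
Local Notation p1 := (affine_point r (- b / (2 * a))).
Local Notation p2 := (affine_point (- r) (- b / (2 * a))).
Let a_neq0 := lax_a_neq0 ab0.

Lemma ratio_gt0 : 0 < b / a.
Proof using ab0.
by rewrite (_ : b / a = (a * b) / a ^+ 2) ?divr_gt0 ?exprn_even_gt0//; field.
Qed.

Lemma ratio_sqrt : r ^+ 2 = b / a.
Proof using ab0. by rewrite sqr_sqrtr// ltW// ratio_gt0. Qed.

(** The condition is (A / B)^2 < b / a; multiplying by the positive number (a B)^2 turns it into the
    sign of [lax_k]. *)
Lemma strip_lax_k (A B : R) : B != 0 -> (- r < A / B < r) = (lax_k a b A B < 0).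
Proof using ab0.
move=> B0; rewrite -ltr_norml -(ltr_pXn2r (n := 2)) ?nnegrE ?sqrtr_ge0//.
rewrite real_normK ?num_real// ratio_sqrt /lax_k -subr_lt0.
rewrite -(pmulr_rlt0 _ (_ : 0 < (a * B) ^+ 2)) ?exprn_even_gt0 ?mulf_neq0//.
by congr (_ < 0); field; rewrite B0 a_neq0.
Qed.

Lemma integral_curve_ext (F : 'rV[R]_3 -> 'rV[R]_3) (z z' : R -> 'rV[R]_3) J :
  (forall t, J t -> z t = z' t) -> integral_curve F z J -> integral_curve F z' J.
Proof.
move=> zz [oJ dz]; split=> // t Jt; rewrite -zz//.
apply: near_eq_is_derive (dz t Jt).
by apply: open_near_eq Jt zz; have [] := oJ.
Qed.

Lemma maximal_integral_curve_ext (F : 'rV[R]_3 -> 'rV[R]_3)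
    (z z' : R -> 'rV[R]_3) J :
  (forall t, J t -> z t = z' t) -> maximal_on (integral_curve F) z J ->
  maximal_on (integral_curve F) z' J.
Proof.
move=> zz [hz max]; split; first exact: integral_curve_ext hz.
by move=> c I hc JI cz; apply: max hc JI _ => t Jt; rewrite cz// zz.
Qed.

Lemma open_interval_itvoo (s t x : R) : s < x < t -> open_interval `]s, t[%classic.
Proof.
move=> xst; split; first exact: interval_open.
- exact: interval_is_interval.
- by exists x; rewrite /= in_itv.
Qed.

(** J is the interval between the zeros of the denominator nearest to t0 on either side: it contains
    neither zero by [lax_solE], and the explicit solution fills the whole interval. *)
Lemma maximal_lax_interval z J t0 : maximal_on (integral_curve E) z J ->
  J t0 -> z t0 0 2 != 0 -> lax_k a b (z t0 0 0) (z t0 0 2) < 0 ->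
  exists st : R * R,
  [/\ J = `]st.1, st.2[%classic, st.1 < st.2,
      lax_den a b (z t0 0 0) (z t0 0 2) (st.1 - t0) = 0
    & lax_den a b (z t0 0 0) (z t0 0 2) (st.2 - t0) = 0].
Proof using ab0.
move=> [hz max] Jt0 B0; set A := z t0 0 0; set B := z t0 0 2 => k0.
have [[s t] /= [s0 t0_gt0 Ds Dt Dst]] := gcoshB_sinh_neg (a * A) k0.
have zJ := lax_solE ab0 hz Jt0 B0.
exists (s + t0, t + t0) => /=; split; rewrite ?addrK//; last by lra.
apply/esym; set I := `]_, _[%classic.
have DI x : I x -> 0 < lax_den a b A B (x - t0).
  by rewrite /I /= in_itv/= => /andP[sx xt]; apply: Dst; lra.
apply: (max (lax_row a b t0 A B (A ^+ 2 + 2 * z t0 0 1 * B))).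
- apply: lax_row_integral => //.
    by apply: (@open_interval_itvoo _ _ t0); lra.
  by move=> x /DI/gt_eqF->.
- have [[_ iJ _] _] := hz.
  move=> x Jx; rewrite /I /= in_itv/=.
  apply/andP; split; rewrite ltNge; apply/negP => h.
    have /zJ[] : J (s + t0) by apply: iJ Jx Jt0 _ _; lra.
    by rewrite addrK {1}/lax_den -/A -/B Ds ltxx.
  have /zJ[] : J (t + t0) by apply: iJ Jt0 Jx _ _; lra.
  by rewrite addrK {1}/lax_den -/A -/B Dt ltxx.
- by move=> x /zJ[].
Qed.

(** The affine coordinates of the projected curve extend continuously to both ends of J, where each
    limit is p1 or p2. The two limits differ because the first coordinate has a derivative without
    zeros inside J. *)
Lemma strip_leaf_joining z J : maximal_on (integral_curve E) z J ->
  (forall t, J t -> z t != 0) -> proj_image (z @` J) `<=` strip r ->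
  leaf_joining E (proj_image (z @` J)) p1 p2.
Proof using ab0.
move=> max z_neq0 sub; have [hz _] := max.
have [[_ _ [t0 Jt0]] _] := hz.
have L0 : ~ (z @` J) 0 by move=> [t /z_neq0/eqP].
have /(proj_image_subP (@cone_strip R r) L0) zstrip := sub.
have [B0 k0] : z t0 0 2 != 0 /\ lax_k a b (z t0 0 0) (z t0 0 2) < 0.
  have [z3] : [set z : 'rV[R]_3 | z 0 2 != 0 /\ - r < z 0 0 / z 0 2 < r] (z t0).
    by apply: zstrip; exists t0.
  by rewrite strip_lax_k.
have [[s t] /= [JE st Ds Dt]] := maximal_lax_interval max Jt0 B0 k0.
move: B0 k0 Ds Dt (lax_solE ab0 hz Jt0 B0).
set A : R := z t0 0 0; set B : R := z t0 0 2 => B0 k0 Ds Dt zJ.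
pose k := A ^+ 2 + 2 * z t0 0 1 * B.
have {}zJ x : J x -> 0 < lax_den a b A B (x - t0) /\ z x = lax_row a b t0 A B k x.
  exact: zJ.
(* The curve has to be total with nonzero values, so a default point is used at times outside J
   where z may vanish. *)
pose junk : punctured R := Sub (affine_row 0 0) (affine_row_punctured 0 0).
pose c x : punctured R := insubd junk (z x).
have cE x : J x -> set_val (c x) = z x.
  by move=> Jx; rewrite /c [LHS]insubdK//; apply/mem_set; exact: z_neq0.
pose D x := lax_den a b A B (x - t0); pose D' x := lax_dden a b A B (x - t0).
have dD (x : R) : is_derive x 1 D (D' x) := is_derive_lax_den a b A B t0 x.
have dD' (x : R) : is_derive x 1 D' (lax_k a b A B * D x).
  exact: is_derive_lax_dden.
(* X and Y are z1 / z3 and z2 / z3 with the denominators cleared: polynomials in D and D', defined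
   for all times. *)
pose X x := D' x * - (a * B)^-1.
pose Y x := k / (2 * B ^+ 2) * (D x * D x) - 2^-1 * (X x * X x).
have dX (x : R) : is_derive x 1 X (- (a * B)^-1 * (lax_k a b A B * D x)).
  apply: (is_derive_eq (is_derive_funM (dD' x) (is_derive_fun_cst _ x))).
  by rewrite mulr0 add0r.
have dY (x : R) := is_derive_funB
  (is_derive_funZ (k / (2 * B ^+ 2)) (is_derive_funM (dD x) (dD x)))
  (is_derive_funZ 2^-1 (is_derive_funM (dX x) (dX x))).
have cXY x : J x -> rp2_pi (c x) = affine_point (X x) (Y x).
  move=> Jx; have [Dx zx] := zJ x Jx.
  apply/rp2_pi_eqP; exists (B / D x); first by rewrite mulf_neq0// invr_eq0 gt_eqF.
  rewrite cE// zx -[set_val _]/(row3 (X x) (Y x) 1) [RHS]row3_eta !mxE /=.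
  rewrite /lax_row /lax_sol /Y /X /= -/(D x) -/(D' x).
  have {}Dx : D x != 0 by rewrite gt_eqF.
  rewrite mulr1; move: (D x) (D' x) Dx => d d' d0.
  by congr row3; field; rewrite ?d0 ?B0 ?a_neq0.
have ends x : D x = 0 -> X x ^+ 2 = r ^+ 2 /\ Y x = - b / (2 * a).
  move=> Dx; have e := lax_dden_sqr a b A B (x - t0).
  rewrite -/(D x) Dx expr0n mulr0 subr0 -/(D' x) in e.
  have X2 : X x ^+ 2 = r ^+ 2.
    by rewrite ratio_sqrt /X exprMn e; field; rewrite B0 a_neq0.
  split=> //; rewrite /Y Dx mul0r -expr2 X2 ratio_sqrt.
  by field; rewrite a_neq0.
have Xst : X s != X t.
  have [|x xst e] := @MVT R X (fun x => - (a * B)^-1 * (lax_k a b A B * D x)) s t st.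
  - by apply: continuous_subspaceT => x; exact: is_derive_continuous (dX x).
  - rewrite eq_sym -subr_eq0 e; apply: mulf_neq0; last by rewrite subr_eq0 gt_eqF.
    have /zJ[Dx _] : J x by rewrite JE.
    by rewrite !mulf_neq0 ?oppr_eq0 ?invr_eq0 ?mulf_neq0 ?(gt_eqF Dx) ?(lt_eqF k0).
have [[Xs Ys] [Xt Yt]] := (ends s Ds, ends t Dt).
have XY_cont := affine_point_continuous dX dY.
have hst x : s < x < t -> rp2_pi (c x) = affine_point (X x) (Y x).
  by move=> xst; apply: cXY; rewrite JE.
have low := lower_end_cvg st hst (XY_cont s).
have upp := upper_end_cvg st hst (XY_cont t).
rewrite -JE in low upp; rewrite -/(Y s) -/(Y t) in low upp; rewrite Ys Yt in low upp.
exists c, J; split.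
- by apply: maximal_integral_curve_ext max => x /cE.
- apply/seteqP; split=> [_ [u [x Jx zu] <-]|_ [x Jx <-]].
    by exists x => //; congr rp2_pi; apply: val_inj; exact: (etrans (cE x Jx) zu).
  by exists (c x) => //; exists x => //; rewrite cE.
(* Each end value of X is r or - r; equal signs contradict [Xst], and the two remaining cases are
   the two orders of p1 and p2. *)
- move/eqP: Xs; rewrite eqf_sqr => /orP[/eqP Xs|/eqP Xs];
  move/eqP: Xt; rewrite eqf_sqr => /orP[/eqP Xt|/eqP Xt];
  rewrite Xs Xt in low upp Xst.
  + by rewrite eqxx in Xst.
  + by left.
  + by right.
  + by rewrite eqxx in Xst.
Qed.

(** Near p1 the product z1 z3 is positive and near p2 it is negative, so z1 vanishes at some time
    while z3 does not. The energy at that time makes [lax_k] negative, and conservation spreads this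
    sign to the whole curve. *)
Lemma leaf_joining_strip F : leaf_joining E F p1 p2 -> F `<=` strip r.
Proof using ab0.
move=> [c [J [[hz _] -> ends]]].
have r0 : 0 < r by rewrite sqrtr_gt0 ratio_gt0.
have [[_ iJ J0] _] := hz.
pose z t := set_val (c t); rewrite -[fun t => set_val _]/z in hz.
(* Scaling z by l multiplies z1 z3 by l^2, so its sign is well defined on RP(2); the factor [sgn]
   treats both endpoints together. *)
have ev (sgn : R) : sgn != 0 -> forall G : set_system R, Filter G ->
    forall p : R, 0 < sgn * p ->
    (fun t => rp2_pi (c t)) @ G --> affine_point p (- b / (2 * a)) ->
    \forall t \near G, 0 < sgn * (z t 0 0 * z t 0 2).
  move=> s0 G FG p p0.
  apply: (rp2_cvg_cone (U := [set z : 'rV[R]_3 | 0 < sgn * (z 0 0 * z 0 2)])).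
  - move=> l u l0 /= u0; rewrite !mxE.
    rewrite (_ : _ * _ = l ^+ 2 * (sgn * (u 0 0 * u 0 2))); last by ring.
    by rewrite pmulr_rgt0// exprn_even_gt0.
  - apply: (@open_comp _ _ (fun u : 'rV[R]_3 => sgn * (u 0 0 * u 0 2))
      [set x | 0 < x]); last exact: open_gt.
    have cc i : continuous (fun u : 'rV[R]_3 => u 0 i) by exact: coord_continuous.
    move=> u _; have c02 := continuousM (cc 0 u) (cc 2 u).
    exact: (continuousM (s := fun=> sgn) (@cst_continuous _ _ sgn u) c02).
  - by rewrite /= !mxE /= mulr1.
have [t1 Jt1 [t2 Jt2 [h1 h2]]] : exists2 t1, J t1 & exists2 t2, J t2 &
    0 < z t1 0 0 * z t1 0 2 /\ z t2 0 0 * z t2 0 2 < 0.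
  have Fl := lower_end_filter J0; have Fu := upper_end_filter J0.
  have hpos (G : set_system R) (FG : Filter G) :
      (fun t => rp2_pi (c t)) @ G --> p1 -> \forall t \near G, 0 < z t 0 0 * z t 0 2.
    move=> cvg; have := ev 1 (oner_neq0 _) G FG r _ cvg.
    by rewrite mul1r => /(_ r0); apply: filterS => t; rewrite mul1r.
  have hneg (G : set_system R) (FG : Filter G) :
      (fun t => rp2_pi (c t)) @ G --> p2 -> \forall t \near G, z t 0 0 * z t 0 2 < 0.
    move=> cvg; have := ev (-1) _ G FG (- r) _ cvg.
    rewrite mulrNN mul1r oppr_eq0 oner_eq0 => /(_ isT r0).
    by apply: filterS => t; rewrite mulN1r oppr_gt0.
  case: ends => -[lo up].
  - have [x Jx hx] := filter_from_near (fun s Js => conj Js (lexx s)) (hpos _ _ lo).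
    have [y Jy hy] := filter_from_near (fun s Js => conj Js (lexx s)) (hneg _ _ up).
    by exists x => //; exists y.
  - have [x Jx hx] := filter_from_near (fun s Js => conj Js (lexx s)) (hpos _ _ up).
    have [y Jy hy] := filter_from_near (fun s Js => conj Js (lexx s)) (hneg _ _ lo).
    by exists x => //; exists y.
have z3 t : J t -> z t 0 2 != 0.
  move=> Jt; apply: contraTneq h1 => /(lax_z3_zero hz Jt)/(_ _ Jt1) ->.
  by rewrite mulr0 ltxx.
have [t3 Jt3 /eqP] : exists2 x, J x & z x 0 0 * z x 0 2 = 0.
  apply: (interval_IVT0 (f := fun x => z x 0 0 * z x 0 2) iJ _ Jt2 Jt1).
  - move=> x Jx; have [d1 _ d3] := lax_curve_derive hz Jx.
    exact: is_derive_continuous (is_derive_funM d1 d3).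
  - exact: ltW.
  - exact: ltW.
rewrite mulf_eq0 (negbTE (z3 _ Jt3)) orbF => /eqP z10.
move=> _ [t Jt <-]; apply/(mem_proj_image _ (@cone_strip R r)); split; first exact: z3.
rewrite strip_lax_k ?z3// /lax_k.
have -> : a ^+ 2 * z t 0 0 ^+ 2 - a * b * z t 0 2 ^+ 2 =
    a * (a * z t 0 0 ^+ 2 - b * z t 0 2 ^+ 2) by ring.
rewrite (lax_energy hz Jt Jt3) z10 expr0n mulr0 sub0r mulrN mulrA oppr_lt0.
by rewrite mulr_gt0// exprn_even_gt0//= z3.
Qed.

End Leaves.

(** * Completeness *)

Section Extension.
Context {R : realType}.

(** The ray starts at a point of J, so the union has no gap. *)
Lemma open_interval_upper (J : set R) t0 : open_interval J -> J t0 ->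
  open_interval (J `|` `]t0, +oo[%classic).
Proof.
move=> [oJ iJ _] Jt0; split; last by exists t0; left.
  by apply: openU => //; exact: interval_open.
move=> x y Ix Iy z /andP[xz zy].
have [zt|tz] := leP z t0; last by right; rewrite /= in_itv/= tz.
left; case: Ix => [Jx|]; last first.
  by rewrite /= in_itv/= andbT => /lt_le_trans/(_ xz); rewrite ltNge zt.
by apply: iJ Jx Jt0 _ _; rewrite xz zt.
Qed.

Lemma open_interval_lower (J : set R) t0 : open_interval J -> J t0 ->
  open_interval (J `|` `]-oo, t0[%classic).
Proof.
move=> [oJ iJ _] Jt0; split; last by exists t0; left.
  by apply: openU => //; exact: interval_open.
move=> x y Ix Iy z /andP[xz zy].
have [tz|zt] := leP t0 z; last by right; rewrite /= in_itv/= zt.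
left; case: Iy => [Jy|]; last first.
  by rewrite /= in_itv/= => /(le_lt_trans zy); rewrite ltNge tz.
by apply: iJ Jt0 Jy _ _; rewrite tz zy.
Qed.

Lemma upper_not_ubound (J : set R) t0 :
  (J `|` `]t0, +oo[%classic) = J -> ~ has_ubound J.
Proof.
move=> JE [M hM].
have : J (Num.max M t0 + 1).
  rewrite -JE; right; rewrite /= in_itv/= andbT.
  by rewrite (@le_lt_trans _ _ (Num.max M t0)) ?ltrDl// le_max lexx orbT.
by move=> /hM; rewrite leNgt (@le_lt_trans _ _ (Num.max M t0)) ?ltrDl// le_max lexx.
Qed.

Lemma lower_not_lbound (J : set R) t0 :
  (J `|` `]-oo, t0[%classic) = J -> ~ has_lbound J.
Proof.
move=> JE [M hM].
have : J (Num.min M t0 - 1).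
  rewrite -JE; right; rewrite /= in_itv/=.
  by rewrite (@lt_le_trans _ _ (Num.min M t0)) ?gtrDl ?oppr_lt0// ge_min lexx orbT.
move=> /hM; rewrite leNgt (@lt_le_trans _ _ (Num.min M t0)) ?gtrDl ?oppr_lt0//.
by rewrite ge_min lexx.
Qed.

End Extension.

Theorem proposition7p4 (R : realType) (q : sl2 R -> sl2 R -> R)
    (Phi : 'End(sl2 R)) (lambda mu zeta : R) (v1 v2 v3 : sl2 R)
    (L : set 'rV[R]_3) :
  left_invariant_metric q ->
  associated_iso q Phi ->
  leigenvalue Phi lambda ->
  alg_mult Phi lambda = (geom_mult Phi lambda + 1)%N ->
  adapted_basis q Phi lambda mu zeta v1 v2 v3 ->
  let eta := mu^-1 in
  let nu := lambda^-1 in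
  let a := eta - nu in
  let b := zeta * nu ^+ 2 in
  let E := lax_field a b in
  let r := Num.sqrt (b / a) in
  let p1 := affine_point r (- b / (2 * a)) in
  let p2 := affine_point (- r) (- b / (2 * a)) in
  let Linf := proj_image L in
  0 < a * b ->
  trajectory E L ->
  ~ L 0 ->
  forall (g : R -> 'M[R]_2) (J : set R),
    geodesic_of_trajectory q Phi v1 v2 v3 L g J ->
    [/\ Linf `<=` line_z3 R -> complete_on J,
        ~ (Linf `<=` line_z3 R) -> ~ complete_on J
      & ~ complete_on J ->
        (~ (Linf `<=` strip r) -> pos_complete_on J \/ neg_complete_on J) /\
        (~ (Linf `<=` strip r) <-> ~ leaf_joining E Linf p1 p2)].
Proof.
move=> [_ qC _] PhiP _ _ [frame gram bracket PhiE _] eta nu a b E r p1 p2 Linf.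
move=> ab0 [z [Jz [maxz LE]]] L0 g J [maxg gL].
have [geo _] := maxg.
have hz := geodesic_lax frame gram bracket qC PhiP PhiE geo.
rewrite -/eta -/nu -/a -/b in hz.
set w := lax_curve Phi v1 v2 v3 g in gL hz.
have oJ : open_interval J by have [] := hz.
have [oJ' iJ J0] := oJ.
have wL t : J t -> L (w t) by move=> Jt; rewrite -gL; exists t.
have lineP := proj_image_subP (@cone_line R) L0.
have stripP := proj_image_subP (@cone_strip R r) L0.
have complete_z3 t : J t -> w t 0 2 = 0 -> complete_on J.
  exact: (geodesic_z3_zero frame gram bracket qC PhiP PhiE maxg).
split.
- move=> /lineP LZ; have [t0 Jt0] := J0.
  by apply: (complete_z3 t0) => //; exact: LZ (wL _ Jt0).
- move=> notline JT; apply: notline; apply/lineP => u Lu.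
  apply: contrapT => /eqP u3; move: Lu; rewrite -gL => -[t0 Jt0 wu].
  rewrite -wu in u3.
  (* At a point of L off the plane z3 = 0 the denominator has a zero; a complete curve would pass
     through that time, where the denominator should be positive. *)
  have [s Ds] := lax_den_zero ab0 (w t0 0 0) u3.
  have Js : J (s + t0) by rewrite JT.
  have [] := lax_solE ab0 hz Jt0 u3 Js.
  by rewrite addrK Ds ltxx.
- move=> notcomplete.
  have z3 t : J t -> w t 0 2 != 0.
    by move=> Jt; apply: contra_notN notcomplete => /eqP; exact: complete_z3.
  split; last first.
    split.
      by move=> notstrip /(leaf_joining_strip ab0).
    (* The leaf is parametrised by the maximal integral curve z defining L, as [leaf_joining] asks
       for maximality; w is only known to be an integral curve. *)
    move=> notleaf sub; apply: notleaf; rewrite /Linf LE.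
    apply: (strip_leaf_joining ab0 maxz); last by rewrite -LE.
    by move=> t Jt; apply: contra_notN L0 => /eqP <-; rewrite LE; exists t.
  move=> notstrip.
  (* Since z3 never vanishes, a curve that leaves the strip has [lax_k] nonnegative at some time. *)
  have [t0 Jt0 k0] : exists2 t0, J t0 & 0 <= lax_k a b (w t0 0 0) (w t0 0 2).
    apply: contrapT => no; apply: notstrip; apply/stripP => u.
    rewrite -gL => -[t Jt <-] /=; split; first exact: z3.
    rewrite (strip_lax_k ab0) ?z3// ltNge; apply/negP => kt.
    by apply: no; exists t.
  have ext I : open_interval I -> J `<=` I ->
      (forall t, I t -> 0 < lax_den a b (w t0 0 0) (w t0 0 2) (t - t0)) -> I = J.
    exact: (geodesic_z3_neq0 frame gram bracket qC PhiP PhiE ab0 maxg Jt0 (z3 _ Jt0)).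
  have wJ t (Jt : J t) := (lax_solE ab0 hz Jt0 (z3 _ Jt0) Jt).1.
  (* With [lax_k] nonnegative, the sign of a A tells on which side of t0 the denominator stays
     positive; by maximality, J contains the whole half-line on that side. *)
  have [aA|aA] := leP (a * w t0 0 0) 0.
    left; apply: (@upper_not_ubound _ _ t0); apply: ext.
    - exact: open_interval_upper.
    - by move=> t; left.
    - move=> t [/wJ//|]; rewrite /= in_itv/= andbT => tt.
      by apply: lax_den_gt0 => //; rewrite mulr_le0_ge0// subr_ge0 ltW.
  right; apply: (@lower_not_lbound _ _ t0); apply: ext.
  - exact: open_interval_lower.
  - by move=> t; left.
  - move=> t [/wJ//|]; rewrite /= in_itv/= => tt.
    by apply: lax_den_gt0 => //; rewrite mulr_ge0_le0 ?(ltW aA)// subr_le0 ltW.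
Qed.
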